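(* Let $n \geq 6$ be an even integer. Then $R(W_n, S_n) \leq \frac{5n}{2} - 1$.
   Context: All graphs are finite and simple. $\overline{G}$ denotes the complement of a graph $G$. For two graphs $G_1$ and $G_2$, the Ramsey number $R(G_1,G_2)$ is the smallest positive integer $N$ such that for every graph $G$ on $N$ vertices, $G$ contains $G_1$ as a subgraph (not necessarily induced) or $\overline{G}$ contains $G_2$ as a subgraph (not necessarily induced). The wheel $W_m$ is the graph on $m+1$ vertices obtained from the cycle $C_m$ on $m$ vertices by adding one new vertex adjacent to every vertex of $C_m$. The star $S_n$ is the complete bipartite graph $K_{1,n-1}$, which has $n$ vertices. *)

(* Defs.v *)
From mathcomp Require Import all_boot.

Set Implicit Arguments.
Unset Strict Implicit.
Unset Printing Implicit Defensive.

Record sgraph := SGraph {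
  vertex :> finType;
  edge : rel vertex;
  edge_sym : symmetric edge;
  edge_irrefl : irreflexive edge }.

Section Complement.
Variable G : sgraph.

Definition compl_edge : rel G := fun x y => (x != y) && ~~ edge x y.

Lemma compl_edge_sym : symmetric compl_edge.
Proof. by move=> x y; rewrite /compl_edge eq_sym edge_sym. Qed.

Lemma compl_edge_irrefl : irreflexive compl_edge.
Proof. by move=> x; rewrite /compl_edge eqxx. Qed.

Definition complement : sgraph := SGraph compl_edge_sym compl_edge_irrefl.
End Complement.

(* [G] contains [H] as a not necessarily induced subgraph. *)
Definition contains (G H : sgraph) : Prop :=
  exists2 f : H -> G, injective f & forall x y : H, edge x y -> edge (f x) (f y).

Section Cycle.
Variable m : nat.

(* [ordS] is the successor modulo [m]. This is the cycle C_m for [2 < m]; the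
   disequality only matters for [m = 1], where [ordS] has a fixed point. *)
Definition cycle_edge : rel 'I_m :=
  fun i j => (i != j) && ((j == ordS i) || (i == ordS j)).

Lemma cycle_edge_sym : symmetric cycle_edge.
Proof. by move=> i j; rewrite /cycle_edge eq_sym orbC. Qed.

Lemma cycle_edge_irrefl : irreflexive cycle_edge.
Proof. by move=> i; rewrite /cycle_edge eqxx. Qed.

Definition cycle_graph : sgraph := SGraph cycle_edge_sym cycle_edge_irrefl.
End Cycle.

Section Cone.
Variable G : sgraph.

(* [None] is the new vertex, adjacent to all vertices of [G]. *)
Definition cone_edge : rel (option G) := fun u v =>
  match u, v with
  | Some x, Some y => edge x y
  | None, None => false
  | _, _ => true
  end.

Lemma cone_edge_sym : symmetric cone_edge.
Proof. by case=> [x|] [y|] //=; rewrite edge_sym. Qed.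

Lemma cone_edge_irrefl : irreflexive cone_edge.
Proof. by case=> [x|] //=; rewrite edge_irrefl. Qed.

Definition cone : sgraph := SGraph cone_edge_sym cone_edge_irrefl.
End Cone.

Definition wheel (m : nat) : sgraph := cone (cycle_graph m).

Section CompleteBipartite.
Variables a b : nat.

Definition bipartite_edge : rel ('I_a + 'I_b)%type := fun u v =>
  match u, v with
  | inl _, inr _ | inr _, inl _ => true
  | _, _ => false
  end.

Lemma bipartite_edge_sym : symmetric bipartite_edge.
Proof. by case=> x [] y. Qed.

Lemma bipartite_edge_irrefl : irreflexive bipartite_edge.
Proof. by case. Qed.

Definition complete_bipartite : sgraph :=
  SGraph bipartite_edge_sym bipartite_edge_irrefl.
End CompleteBipartite.

(* The index of a star is its number of vertices. *)
Definition star (n : nat) : sgraph := complete_bipartite 1 n.-1.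

Definition ramsey_prop (G1 G2 : sgraph) (N : nat) : Prop :=
  forall G : sgraph, #|G| = N -> contains G G1 \/ contains (complement G) G2.

(* [r] is the Ramsey number R(G1, G2). *)
Definition is_ramsey_number (G1 G2 : sgraph) (r : nat) : Prop :=
  [/\ 0 < r, ramsey_prop G1 G2 r
    & forall N, 0 < N -> ramsey_prop G1 G2 N -> r <= N].

Lemma is_ramsey_number_unique (G1 G2 : sgraph) (r s : nat) :
  is_ramsey_number G1 G2 r -> is_ramsey_number G1 G2 s -> r = s.
Proof.
case=> r0 rP rmin [s0 sP smin].
by apply/eqP; rewrite eqn_leq rmin ?smin.
Qed.

(* Main.v *)
Require Import Defs.
From Stdlib Require Classical_Prop.
From mathcomp Require Import all_boot zify.
Set Implicit Arguments.
Unset Strict Implicit.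
Unset Printing Implicit Defensive.

(** Write n = 2m, so that there are 5m - 1 vertices, and suppose that no vertex
    has 2m - 1 non-neighbours, since these would give a star in the complement.
    Then every neighbourhood has at least 3m vertices, and in a set H of exactly
    3m vertices each vertex has more than m neighbours within H. A cycle of
    length 2m inside a neighbourhood closes to a wheel, so assume that there is
    none.

    Parity is what makes the exact length 2m hard to reach. It is handled by
    capped cycles: a cycle p together with a vertex w off p that is adjacent to
    both ends of the closing edge of p. It yields cycles of both lengths |p| and
    |p| + 1, so no capped cycle has size 2m - 1 or 2m, and one can enlarge a
    capped cycle by one or two vertices at a time without jumping over the
    target. Capped cycles exist because H contains a triangle: otherwise the
    neighbours of a vertex include m independent vertices, and a cycle that
    alternates between these and the rest of H can be enlarged, two vertices at
    a time, until it has length 2m ([no_independent]).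

    Take a capped cycle (w, p) in H with k = |p| < 2m - 1 as large as possible;
    let S consist of w and p, and R be the rest of H. Let z in R have neighbours
    a and b on p. The path through z which joins the successors of a and b
    forces these successors to have disjoint neighbourhoods in R, or two vertices
    could be added, and to have few neighbours in S, or one vertex could be
    added. As degrees exceed a third of |H|, the two requirements are
    incompatible up to one boundary case, which is excluded separately. So z has
    at most two neighbours in S ([dS_le2]) and H falls into two almost unrelated
    parts. Then R is dense; this gives k > m ([max_capped_gt]), and it shows that
    fewer than m vertices of S have two or more neighbours in R ([card_busy]) and
    that some vertex of R has at most one neighbour in S ([not_all_two]). All
    this is collected in [splitting].

    Two such splittings contradict each other ([wheel_cycle]). Split a 3m-subset
    of some neighbourhood into S and R, and let u in R have at most one neighbour
    in S. Then u has at least m neighbours in R. Split a 3m-subset of N(u) that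
    contains them into S' and R'. One of these m neighbours, x, is not among the
    vertices of S' with two or more neighbours in R'. Now x misses almost all of S, as
    x is in R, and almost all of S' or of R', whichever part does not contain x.
    These two sets share at most one vertex, since u is adjacent to all of the
    second and to at most one vertex of S. So x has at least 2m - 1
    non-neighbours. *)

(** Only inequalities between natural numbers are passed to [lia]: the Boolean
    facts about edges and membership make it very slow. *)
Ltac arith :=
  repeat match goal with
  | H : is_true ?b |- _ =>
    lazymatch b with
    | leq _ _ => fail
    | andb (leq _ _) (leq _ _) => fail
    | _ => clear H
    end
  | H : forall _ : _, _ |- _ => clear H
  | H : and4 _ _ _ _ |- _ => clear H
  end; lia.

(** * Walks, counting *)

Section Walks.
Variables (T : finType) (e : rel T).
Hypothesis e_sym : symmetric e.

(** [s] lists all the vertices of the walk, [a] and [b] included, so that walks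
    are joined by plain concatenation along an edge. *)
Definition walk a b (s : seq T) :=
  if s is x :: s' then [&& x == a, path e x s' & last x s' == b] else false.

Lemma walk1 a : walk a a [:: a].
Proof. by rewrite /= !eqxx. Qed.

Lemma walk_cat a b c d s t :
  walk a b s -> walk c d t -> e b c -> walk a d (s ++ t).
Proof.
case: s t => [|x s] [|y t] //= /and3P[xa ps /eqP<-] /and3P[/eqP-> pt /eqP<-] ebc.
by rewrite xa cat_path ps last_cat /= ebc pt eqxx.
Qed.

Lemma walk_cons a b c s : e a b -> walk b c s -> walk a c (a :: s).
Proof. by move=> eab wbc; apply: (walk_cat (walk1 a) wbc). Qed.

Lemma walk_rcons a b c s : walk a b s -> e b c -> walk a c (rcons s c).
Proof. by move=> ws ebc; rewrite -cats1; apply: (walk_cat ws (walk1 c)). Qed.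

Lemma walk_rev a b s : walk a b s -> walk b a (rev s).
Proof.
elim: s a => [|x s IHs] a //= /and3P[/eqP<-].
case: s IHs => [|y s] IHs /=; first by move=> _ /eqP<-; rewrite !eqxx.
case/andP=> exy ps lb; rewrite rev_cons; apply: (@walk_rcons b y) => //.
  by apply: IHs; rewrite /= eqxx ps.
by rewrite e_sym.
Qed.

Lemma walk_take a b x0 s i :
  walk a b s -> i < size s -> walk a (nth x0 s i) (take i.+1 s).
Proof.
elim: s a i => [|x s IHs] a [|i] //= /and3P[/eqP<- ps lb] lt_i.
  by rewrite take0 /= !eqxx.
case: s IHs ps lb lt_i => [|y s] //= IHs /andP[exy ps] lb lt_i.
by have:= IHs y i; rewrite !eqxx ps lb exy => /(_ isT lt_i).
Qed.

Lemma walk_drop a b x0 s i :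
  walk a b s -> i < size s -> walk (nth x0 s i) b (drop i s).
Proof.
elim: s a i => [|x s IHs] a [|i] //= /and3P[_ ps lb] lt_i.
  by rewrite eqxx ps.
case: s IHs ps lb lt_i => [|y s] //= IHs /andP[exy ps] lb lt_i.
by apply: (IHs y); rewrite ?eqxx ?ps.
Qed.

Lemma walk_nth0 a b x0 s : walk a b s -> nth x0 s 0 = a.
Proof. by case: s => //= x s /and3P[/eqP]. Qed.

Lemma walk_nth_last a b x0 s : walk a b s -> nth x0 s (size s).-1 = b.
Proof. by case: s => //= x s /and3P[_ _ /eqP<-]; rewrite -last_nth. Qed.

Lemma walk_cycle a b s : walk a b s -> e b a -> cycle e s.
Proof.
case: s => [|x s] //= /and3P[/eqP<- ps /eqP<-] eba.
by rewrite rcons_path ps.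
Qed.

Lemma walk_gt0 a b s : walk a b s -> 0 < size s.
Proof. by case: s. Qed.

Lemma walk_mem_r a b s : walk a b s -> b \in s.
Proof. by case: s => //= x s /and3P[_ _ /eqP<-]; rewrite mem_last. Qed.

Lemma walk_split a b c c' A B : walk a b (A ++ c :: c' :: B) ->
  [/\ walk a c (rcons A c), walk c' b (c' :: B) & e c c'].
Proof.
elim: A a => [|x A IHA] a /=.
  by case/and3P=> /eqP-> /andP[ecc' pB] lb; rewrite eqxx pB lb /= ?eqxx.
case/and3P=> /eqP-> pA lb.
case: A IHA pA lb => [|y A] /= IHA.
  case/andP=> exc /andP[ecc' pB] lb; split; rewrite ?eqxx ?pB ?exc //.
case/andP=> exy pA lb.
have:= IHA y; rewrite eqxx pA lb => /(_ isT)[wA wB ecc'].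
by split=> //; move: wA; rewrite /= !eqxx exy.
Qed.
End Walks.

(** The counting step behind Dirac's and Ore's theorems: with [P] and [Q] the
    adjacency to the two ends of a path, an edge [c c'] of the path with [Q c]
    and [P c'] is a pair of crossing chords. *)
Lemma shift_count (T : eqType) (P Q : pred T) x s :
  (forall A c c' B, x :: s = A ++ c :: c' :: B -> ~~ (Q c && P c')) ->
  count P s + count Q (belast x s) <= size s.
Proof.
elim: s x => [|y s IHs] x //= noX.
have:= noX [::] x y s erefl.
have: count P s + count Q (belast y s) <= size s.
  by apply: IHs => A c c' B def; apply: (noX (x :: A) c c' B); rewrite def.
by case: (Q x); case: (P y); rewrite //=; lia.
Qed.

Lemma card_nbr_seq (T : finType) (P : pred T) (s : seq T) :
  uniq s -> #|[set y | P y] :&: [set x in s]| = count P s.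
Proof.
move=> us; rewrite -size_filter -(card_uniqP (filter_uniq P us)).
by apply: eq_card => y; rewrite !inE mem_filter.
Qed.

Lemma sum_disjoint (I T : finType) (P : pred I) (f : I -> {set T}) (X : {set T}) :
  (forall i j q, P i -> P j -> q \in f i -> q \in f j -> i = j) ->
  (forall i, P i -> f i \subset X) ->
  \sum_(i | P i) #|f i| <= #|X|.
Proof.
move=> dis sub.
have -> : \sum_(i | P i) #|f i| = \sum_(i | P i) \sum_(q in X) (q \in f i : nat).
  apply: eq_bigr => i Pi; rewrite -sum1_card big_mkcond [RHS]big_mkcond.
  apply: eq_bigr => q _; case: ifP => [qf|]; last by case: ifP.
  by rewrite (subsetP (sub i Pi) q qf).
rewrite exchange_big /= -sum1_card; apply: leq_sum => q _.
case: (pickP (fun i => P i && (q \in f i))) => [i /andP[Pi qi]|no].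
  rewrite (bigD1 i) //= qi big1 // => j /andP[Pj ji].
  by case qj: (q \in f j) => //; rewrite (dis j i q) ?eqxx in ji.
by rewrite big1 // => i Pi; have:= no i; rewrite Pi /= => ->.
Qed.

(** * Capped cycles in a set H of 3m vertices *)

Section Host.
Variables (T : finType) (e : rel T).
Hypothesis e_sym : symmetric e.
Hypothesis e_irr : irreflexive e.
Variable H : {set T}.
Implicit Types (x y z a b d h t w : T) (p Q l : seq T).

Definition nb x := [set y | e x y].

Definition has_cycle n :=
  exists s, [/\ cycle e s, uniq s, size s = n & {subset s <= H}].

Lemma has_cycleI n a b s : walk e a b s -> e b a -> uniq s ->
  {subset s <= H} -> size s = n -> has_cycle n.
Proof. by move=> ws eba us sH szs; exists s; split=> //; apply: walk_cycle eba. Qed.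

(** Crossing chords from the ends of the path would close it to a cycle on the
    same vertices. *)
Lemma ham_path_degree h t Q : walk e h t Q -> uniq Q -> {subset Q <= H} ->
  ~ has_cycle (size Q) -> count (e h) Q + count (e t) Q < size Q.
Proof.
move=> wQ uQ sQ noC.
have noX A c c' B : Q = A ++ c :: c' :: B -> ~~ (e t c && e h c').
  move=> defQ; apply/negP=> /andP[etc ehc']; apply: noC.
  move: wQ; rewrite defQ => /walk_split[wA wB _].
  apply: (@has_cycleI _ h c' (rcons A c ++ rev (c' :: B))).
  - by apply: (walk_cat wA (walk_rev e_sym wB)); rewrite e_sym.
  - by rewrite e_sym.
  - have: perm_eq (rcons A c ++ rev (c' :: B)) Q.
      by rewrite defQ -cats1 -catA perm_cat2l /= perm_cons perm_rev.
    by move/perm_uniq->.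
  - move=> x; rewrite mem_cat mem_rev mem_rcons => xQ; apply: sQ.
    by move: xQ; rewrite defQ mem_cat !inE; do ![case/orP|move->];
      rewrite ?orbT // => ->; rewrite ?orbT.
  - by rewrite !size_cat size_rev size_rcons /=; arith.
case: Q wQ noX {uQ sQ noC} => [|x s] //= /and3P[/eqP xh _ /eqP lt] noX.
have:= shift_count (P := e h) (Q := e t) noX.
have: count (e t) (x :: s) = count (e t) (belast x s).
  by rewrite lastI lt -cats1 count_cat /= e_irr; arith.
by rewrite /= xh e_irr; arith.
Qed.

(** The cycle [p] is listed so that its closing edge, between [last w p] and
    [head w p], is the one whose ends are adjacent to the cap [w]. A rearranged
    list with the same two ends is capped by the same [w]. *)
Definition capped w p :=
  [&& walk e (head w p) (last w p) p, uniq (w :: p), all (mem H) (w :: p),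
      e (head w p) (last w p), e w (head w p) & e w (last w p)].

Lemma cappedI w p a b : walk e a b p -> uniq (w :: p) ->
  {subset w :: p <= H} -> e a b -> e w a -> e w b -> capped w p.
Proof.
move=> wp up sub ab wa wb.
have -> : capped w p = [&& walk e a b p, uniq (w :: p), all (mem H) (w :: p),
    e a b, e w a & e w b].
  by case: p wp {up sub} => [|x p] //= /and3P[/eqP xa _ /eqP lb];
    rewrite /capped /= lb xa.
by rewrite wp up ab wa wb !andbT; apply/allP=> x /sub.
Qed.

Lemma cappedP w p : capped w p ->
  exists a b, [/\ walk e a b p, uniq (w :: p), {subset w :: p <= H}, e a b
    & e w a && e w b].
Proof.
case/and5P=> wp up /allP sub ab wab.
by exists (head w p), (last w p); split=> //; case/andP: wab => -> ->.
Qed.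

Lemma capped_rev w p : capped w p -> capped w (rev p).
Proof.
case/cappedP=> a [b [wp up sub ab /andP[wa wb]]].
apply: (cappedI (walk_rev e_sym wp)) => //; last by rewrite e_sym.
  by move: up; rewrite /= mem_rev rev_uniq.
by move=> x; rewrite inE mem_rev => xp; apply: sub; rewrite inE.
Qed.

Variable m : nat.
Hypothesis m_ge3 : 2 < m.
Hypothesis cardH : #|H| = 3 * m.
Hypothesis degH : forall x, x \in H -> m < #|nb x :&: H|.
Hypothesis noC : ~ has_cycle m.*2.

(** Capped cycles of size 2m - 1 and 2m yield a cycle of length 2m, so the size
    may be taken at most 2m - 2; larger sizes up to 2m are then impossible,
    whereas those above 2m are not. *)
Record max_capped w p : Prop := MaxCapped {
  max_cap : capped w p;
  max_size : size p <= m.*2.-2;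
  max_maximal : forall (w' : T) (p' : seq T),
    capped w' p' -> size p < size p' -> size p' <= m.*2 -> False }.

(** The bounds are chosen to make the splittings of two neighbourhoods
    incompatible; see [wheel_cycle]. *)
Definition sparse_split (S : {set T}) : Prop :=
  [/\ S \subset H, m.+2 <= #|S| < m.*2,
      forall z, z \in H :\: S -> #|nb z :&: S| <= 2,
      exists2 y, y \in H :\: S & #|nb y :&: S| <= 1 &
      #|[set x in S | 1 < #|nb x :&: (H :\: S)|]| < m].

Lemma max_capped_rev w p : max_capped w p -> max_capped w (rev p).
Proof.
by case=> cap le tmax; split; rewrite ?size_rev //; apply: capped_rev.
Qed.

Definition rest w p := H :\: [set x in w :: p].

Lemma rest_rev w p : rest w (rev p) = rest w p.
Proof. by apply/setP=> x; rewrite !inE mem_rev. Qed.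

Lemma max_capped_eq w p w' p' : max_capped w p -> capped w' p' -> size p' = size p ->
  max_capped w' p'.
Proof. by case=> _ le tmax cap sz; split=> //; rewrite ?sz. Qed.

Section Top.
Variables (w : T) (p : seq T).
Hypothesis top : max_capped w p.
Local Notation k := (size p).
Local Notation R := (rest w p).
Local Notation x_ := (nth w p).

Lemma k_max : k <= m.*2.-2. Proof. exact: max_size top. Qed.

Lemma sub_p x : x \in w :: p -> x \in H.
Proof. by case: (cappedP (max_cap top)) => a [b [_ _ sub _ _]]; apply: sub. Qed.

Lemma uniq_wp : uniq (w :: p).
Proof. by case: (cappedP (max_cap top)) => a [b [_ us _ _ _]]. Qed.

Lemma x_inj i j : i < k -> j < k -> x_ i = x_ j -> i = j.
Proof.
move=> ik jk eqx; apply/eqP; case/andP: uniq_wp => _ up.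
by rewrite -(nth_uniq w ik jk up) eqx.
Qed.

Lemma x_mem i : i < k -> x_ i \in p. Proof. exact: mem_nth. Qed.

Lemma k_ge2 : 1 < k.
Proof.
case: (cappedP (max_cap top)) => a [b [wp _ _ ab _]].
have:= walk_gt0 wp; rewrite leq_eqVlt => /orP[/eqP k1|//].
have: x_ 0 = x_ k.-1 by rewrite -k1.
by rewrite (walk_nth0 _ wp) (walk_nth_last _ wp) => eab; rewrite eab e_irr in ab.
Qed.

Lemma cap_ends : [/\ walk e (x_ 0) (x_ k.-1) p, e (x_ 0) (x_ k.-1),
  e w (x_ 0) & e w (x_ k.-1)].
Proof.
case: (cappedP (max_cap top)) => a [b [wp _ _ ab /andP[wa wb]]].
by rewrite (walk_nth0 _ wp) (walk_nth_last _ wp).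
Qed.

Lemma restP x : x \in R -> [/\ x \in H, x != w & x \notin p].
Proof. by rewrite !inE negb_or -andbA => /and3P[]. Qed.

Lemma card_wp : #|[set x in w :: p]| = k.+1.
Proof. by rewrite cardsE (card_uniqP uniq_wp). Qed.

Lemma wp_subH : [set x in w :: p] \subset H.
Proof. by apply/subsetP=> x; rewrite inE; apply: sub_p. Qed.

Lemma card_rest : #|R| = 3 * m - k.+1.
Proof. by rewrite cardsD cardH (setIidPr wp_subH) card_wp. Qed.

Definition dS x := count (e x) (w :: p).
Definition dR x := #|nb x :&: R|.

Lemma dSE x : dS x = #|nb x :&: [set y in w :: p]|.
Proof. by rewrite /dS -(card_nbr_seq (e x) uniq_wp). Qed.

Lemma deg_split x : x \in H -> m < dS x + dR x.
Proof.
move=> /degH; rewrite dSE /dR -(cardsID [set y in w :: p] (nb x :&: H)).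
rewrite setIDA -setIA (setIidPr wp_subH) //.
Qed.

(** Replacing the [j - i - 1] vertices strictly between [x_ i] and [x_ j] by [u]
    gives a capped cycle whose size is between [k + 1] and [2m]. *)
Lemma detour i j (u : seq T) y y' : i < j < k -> walk e y y' u -> uniq u ->
  {subset u <= R} -> e (x_ i) y -> e y' (x_ j) ->
  j - i <= size u -> k + size u + i.+1 <= m.*2 + j -> False.
Proof.
move=> /andP[ij jk] wu uu su eiy eyj le1 le2.
case: cap_ends => wp e0 w0 wk.
have ik: i < k by arith.
set p' := take i.+1 p ++ u ++ drop j p.
have sz: size p' = i.+1 + size u + (k - j).
  by rewrite !size_cat size_drop size_takel //; arith.
apply: (max_maximal top (w' := w) (p' := p')); rewrite ?sz; try arith.
have sub: subseq (take i.+1 p ++ drop j p) p.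
  rewrite -{3}(cat_take_drop i.+1 p) cat_subseq // (_ : j = j - i.+1 + i.+1).
    by rewrite -drop_drop drop_subseq.
  by arith.
have mem x : x \in p' -> x \in u \/ x \in p.
  rewrite !mem_cat => /or3P[/mem_take|->|/mem_drop]; by [right|left|right].
apply: (@cappedI _ _ (x_ 0) (x_ k.-1)) => //.
- apply: (walk_cat (walk_take w wp ik)) eiy.
  by apply: (walk_cat wu (walk_drop w wp jk)).
- rewrite cons_uniq uniq_catCA cat_uniq uu (subseq_uniq sub) ?andbT /=.
    apply/andP; split.
      apply/negP=> /mem[/su/restP[_ /eqP]|wp'] //.
      by have:= uniq_wp; rewrite /= wp'.
    apply/hasPn=> x /(mem_subseq sub) xp; apply/negP=> /su/restP[_ _].
    by rewrite xp.
  by case/andP: uniq_wp.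
- move=> x; rewrite inE => /orP[/eqP->|/mem[/su/restP[]|xp]] //.
    by apply: sub_p; rewrite mem_head.
  by apply: sub_p; rewrite inE xp orbT.
Qed.

Lemma split3 i j : i < j -> j.+1 < k ->
  exists l1 mm l2, [/\ p = l1 ++ mm ++ l2, walk e (x_ 0) (x_ i) l1,
    walk e (x_ i.+1) (x_ j) mm & walk e (x_ j.+1) (x_ k.-1) l2].
Proof.
move=> ij jk; case: cap_ends => wp _ _ _.
exists (take i.+1 p), (take (j - i) (drop i.+1 p)), (drop j.+1 p).
have ik: i.+1 < k by arith.
split.
- rewrite -{1}(cat_take_drop i.+1 p); congr (_ ++ _).
  rewrite -{1}(cat_take_drop (j - i) (drop i.+1 p)) drop_drop;
    congr (_ ++ drop _ _).
  by arith.
- by apply: walk_take wp _; arith.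
- have wd := walk_drop w wp ik.
  have e1: (j - i).-1.+1 = j - i by arith.
  have e2: i.+1 + (j - i).-1 = j by arith.
  have lt: (j - i).-1 < size (drop i.+1 p) by rewrite size_drop; arith.
  by have:= walk_take w wd lt; rewrite e1 nth_drop e2.
- exact: (walk_drop w wp jk).
Qed.

(** The capped cycle x_0..x_i z x_j..x_{i+1} y x_{j+1}..x_{k-1} would have two
    more vertices. *)
Lemma reroute i j z y : i < j -> j.+1 < k -> z \in R -> y \in R -> y != z ->
  e z (x_ i) -> e z (x_ j) -> e y (x_ i.+1) -> e y (x_ j.+1) -> False.
Proof.
move=> ij jk zR yR yz ezi ezj eyi eyj.
have [l1 [mm [l2 [defp w1 wm w2]]]] := split3 ij jk.
case: cap_ends => wp e0 w0 wk.
set p' := l1 ++ (z :: rev mm) ++ (y :: l2).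
have pm: perm_eq p' (z :: y :: p).
  apply/permP=> P; rewrite defp /p' /= !count_cat /= count_cat /= count_rev; arith.
have sz: size p' = k.+2 by rewrite (perm_size pm).
apply: (max_maximal top (w' := w) (p' := p')); rewrite ?sz; last first.
- by have:= k_max; arith.
- by [].
have [zH zw zp] := restP zR; have [yH yw yp] := restP yR.
apply: (@cappedI _ _ (x_ 0) (x_ k.-1)) => //.
- apply: (walk_cat w1 (b := x_ i) (c := z)); last by rewrite e_sym.
  apply: (walk_cat (b := x_ i.+1) (c := y)); last by rewrite e_sym.
    by apply: walk_cons ezj (walk_rev e_sym wm).
  by apply: walk_cons eyj w2.
- rewrite cons_uniq (perm_mem pm) (perm_uniq pm) /= !inE !negb_or.
  rewrite eq_sym zw eq_sym yw /= zp yp (eq_sym z) yz /=.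
  exact: uniq_wp.
- move=> x; rewrite inE (perm_mem pm) !inE => /or4P[/eqP->|/eqP->|/eqP->|xp] //.
    by apply: sub_p; rewrite mem_head.
  by apply: sub_p; rewrite inE xp orbT.
Qed.

(** [Q1] followed by [Q2] is a path through the edge [a b], whose ends are
    adjacent to [w]. Crossing chords at any other edge of this path would give a
    capped cycle of size [k + 1]. Crossing chords at the edge [a b] itself are
    allowed, but then neither [h] nor [t] is adjacent to [w], for otherwise [w]
    caps one of the two chords. *)
Lemma edge_path_degree h t a b Q1 Q2 : walk e h a Q1 -> walk e b t Q2 ->
  uniq (w :: Q1 ++ Q2) -> {subset Q1 ++ Q2 <= H} -> e a b -> e w a -> e w b ->
  size (Q1 ++ Q2) = k.+1 ->
  count (e h) (w :: Q1 ++ Q2) + count (e t) (w :: Q1 ++ Q2) <= k.+2.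
Proof.
move=> w1 w2 uQ sQ ab wa wb szQ.
have sQ' x : x \in w :: Q1 ++ Q2 -> x \in H.
  by rewrite inE => /orP[/eqP->|/sQ //]; apply: sub_p; rewrite mem_head.
have bad a' b' (q : seq T) : walk e a' b' q -> perm_eq q (Q1 ++ Q2) -> e a' b' ->
    e w a' -> e w b' -> False.
  move=> wq pq ab' wa' wb'; apply: (max_maximal top (w' := w) (p' := q)).
  - apply: (cappedI wq) => //; first by rewrite /= (perm_mem pq) (perm_uniq pq).
    by move=> x; rewrite inE (perm_mem pq) -in_cons; apply: sQ'.
  - by rewrite (perm_size pq) szQ.
  - by rewrite (perm_size pq) szQ; have:= k_max; arith.
have c1: count (e h) Q1 + count (e t) Q1 < size Q1 + e t a.
  have noX A c c' B : Q1 = A ++ c :: c' :: B -> ~~ (e t c && e h c').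
    move=> def; apply/negP=> /andP[etc ehc'].
    move: w1; rewrite def => /walk_split[wA wB _].
    apply: (bad a b (rev (c' :: B) ++ rcons A c ++ rev Q2)) => //.
      apply: (walk_cat (walk_rev e_sym wB)); last by rewrite e_sym; exact: ehc'.
      by apply: (walk_cat wA (walk_rev e_sym w2)); rewrite e_sym.
    apply/permP=> P; rewrite def -cats1 !count_cat !count_rev /=; arith.
  case: Q1 w1 noX {uQ sQ szQ sQ' bad} => [|x s] //= /and3P[/eqP xh _ /eqP lt] noX.
  have:= shift_count (P := e h) (Q := e t) noX.
  have: count (e t) (x :: s) = count (e t) (belast x s) + e t a.
    by rewrite lastI lt -cats1 count_cat /=; arith.
  by rewrite /= xh e_irr; arith.
have c2: count (e h) Q2 + count (e t) Q2 < size Q2 + e h b.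
  have noX A c c' B : Q2 = A ++ c :: c' :: B -> ~~ (e t c && e h c').
    move=> def; apply/negP=> /andP[etc ehc'].
    move: w2; rewrite def => /walk_split[wA wB _].
    apply: (bad a b (rev Q1 ++ (c' :: B) ++ rev (rcons A c))) => //.
      apply: (walk_cat (walk_rev e_sym w1)); last by exact: ehc'.
      by apply: (walk_cat wB (walk_rev e_sym wA)).
    apply/permP=> P; rewrite def -cats1 !count_cat !count_rev !count_cat /=; arith.
  case: Q2 w2 noX {uQ sQ szQ sQ' bad} => [|x s] //= /and3P[/eqP xh _ /eqP lt] noX.
  have:= shift_count (P := e h) (Q := e t) noX.
  have: count (e t) (x :: s) = count (e t) (belast x s).
    by rewrite lastI lt -cats1 count_cat /= e_irr; arith.
  by rewrite /= xh; arith.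
have exc: e t a -> e h b -> e w h || e w t -> False.
  move=> ta hb /orP[wh|wt].
    apply: (bad h b (Q1 ++ rev Q2)) => //.
      by apply: (walk_cat w1 (walk_rev e_sym w2)); rewrite e_sym.
    by rewrite perm_cat2l perm_rev.
  apply: (bad t a (rev Q2 ++ Q1)) => //.
    by apply: (walk_cat (walk_rev e_sym w2) w1); rewrite e_sym.
  by rewrite perm_catC perm_cat2l perm_rev.
move: szQ exc; rewrite /= !count_cat size_cat (e_sym h w) (e_sym t w).
by case: (e t a) c1; case: (e h b) c2; case: (e w h); case: (e w t) => /= *;
  try arith;
   exfalso; auto.
Qed.

Lemma nonconsec i z : z \in R -> i.+1 < k -> e z (x_ i) -> e z (x_ i.+1) -> False.
Proof.
move=> zR ik ei ei1; have:= k_max => kmax.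
apply: (@detour i i.+1 [:: z] z z); rewrite ?walk1 ?ltnSn //=; try arith.
- by move=> x; rewrite mem_seq1 => /eqP->.
- by rewrite e_sym.
Qed.

(** Here the roles change: [z] becomes the cap and [w] joins the cycle. *)
Lemma nonconsec_cap z : z \in R -> e z w -> e z (x_ k.-1) -> False.
Proof.
move=> zR zw zk; have [zH zNw zp] := restP zR; case: cap_ends => wp e0 w0 wk.
have kmax := k_max; have k2 := k_ge2.
apply: (max_maximal top (w' := z) (p' := w :: p)); rewrite /= ?ltnSn //;
  last by arith.
apply: (cappedI (walk_cons w0 wp)) => //.
- by rewrite cons_uniq uniq_wp inE negb_or zNw zp.
- move=> x; rewrite inE => /orP[/eqP->//|]; exact: sub_p.
Qed.

(** Both bounds come from the path from [x_ i.+1] to [x_ j.+1] through [z] which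
    keeps the closing edge of [p]. When [k = 2m - 2] the path through [w] has
    2m vertices, so every pair of crossing chords is excluded; this gains
    one. *)
Lemma pair_deg i j z : i < j -> j.+1 < k -> z \in R -> e z (x_ i) -> e z (x_ j) ->
  m.*2 <= k + dR (x_ i.+1) + dR (x_ j.+1) /\
  (k = m.*2.-2 -> 3 <= dR (x_ i.+1) + dR (x_ j.+1)).
Proof.
move=> ij jk zR zi zj; have [zH zNw zp] := restP zR.
have [l1 [mm [l2 [defp w1 wm w2]]]] := split3 ij jk.
case: cap_ends => wp e0 w0 wk.
set h := x_ i.+1; set t := x_ j.+1.
have hH: h \in H by apply: sub_p; rewrite inE x_mem ?orbT //; arith.
have tH: t \in H by apply: sub_p; rewrite inE x_mem ?orbT //; arith.
have dh := deg_split hH; have dt := deg_split tH.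
pose Q1 := mm ++ z :: rev l1.
have wQ1: walk e h (x_ 0) Q1.
  apply: (walk_cat wm) (_ : e (x_ j) z); last by rewrite e_sym.
  by apply: walk_cons zi (walk_rev e_sym w1).
have wQ2: walk e (x_ k.-1) t (rev l2) by apply: walk_rev.
(* Q1 ends and rev l2 begins at the two ends of the closing edge of p. *)
have pm: perm_eq (Q1 ++ rev l2) (z :: p).
  apply/permP=> P; rewrite defp /Q1 /= !count_cat /= !count_rev; arith.
have pmw: perm_eq (Q1 ++ w :: rev l2) (w :: Q1 ++ rev l2).
  by rewrite (perm_catCA Q1 [:: w] (rev l2)).
have uQ: uniq (w :: Q1 ++ rev l2).
  rewrite /= (perm_mem pm) (perm_uniq pm) /= inE negb_or eq_sym zNw zp.
  exact: uniq_wp.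
have sQ: {subset w :: Q1 ++ rev l2 <= H}.
  move=> x; rewrite inE (perm_mem pm) inE => /or3P[/eqP->|/eqP->|xp] //.
    by apply: sub_p; rewrite mem_head.
  by apply: sub_p; rewrite inE xp orbT.
have sz: size (Q1 ++ rev l2) = k.+1 by rewrite (perm_size pm).
have cnt v : count (e v) (w :: Q1 ++ rev l2) = dS v + e v z.
  by rewrite /= (permP pm) /dS /=; arith.
split.
  have:= edge_path_degree wQ1 wQ2 uQ _ _ w0 wk sz; rewrite !cnt => /(_ _ _)X.
  have: dS h + dS t <= k.+2.
    apply: leq_trans (X _ e0); first by arith.
    by move=> x xQ; apply: sQ; rewrite inE xQ orbT.
  arith.
move=> k2m; have szw: size (Q1 ++ w :: rev l2) = m.*2.
  by rewrite (perm_size pmw) /= sz; arith.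
have:= @ham_path_degree h t (Q1 ++ w :: rev l2).
rewrite (perm_uniq pmw) szw !(permP pmw) !cnt => X.
suff: dS h + dS t < m.*2 by arith.
apply: leq_ltn_trans (X _ uQ _ noC); first by arith.
  apply: (walk_cat wQ1) (_ : e (x_ 0) w); last by rewrite e_sym.
  by apply: walk_cons wk wQ2.
by move=> x; rewrite (perm_mem pmw) => /sQ.
Qed.

(** The last vertex of [p] is left out because the edge to its successor is the
    closing edge, which has to survive the rearrangements. *)
Definition links z := [set a in p | e z a & a != x_ k.-1].
Definition succ a := x_ (index a p).+1.

Lemma linksP z a : a \in links z ->
  [/\ (index a p).+1 < k, x_ (index a p) = a & e z a].
Proof.
rewrite inE => /and3P[ap eza aN]; have ip: index a p < k by rewrite index_mem.
have xa: x_ (index a p) = a by rewrite nth_index.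
split=> //; rewrite ltn_neqAle ip andbT.
by apply: contraNneq aN => eqk; rewrite -eqk /= xa.
Qed.

(** The only neighbours not counted in [links] are [w] and the last vertex of
    [p], and these two are not both adjacent to [z]. *)
Lemma dS_links z : z \in R -> dS z <= #|links z|.+1.
Proof.
move=> zR; rewrite dSE.
have up: uniq p by case/andP: uniq_wp.
have sub: nb z :&: [set y in w :: p] \subset
    links z :|: ((if e z w then [set w] else set0) :|:
                 (if e z (x_ k.-1) then [set x_ k.-1] else set0)).
  apply/subsetP=> y; rewrite !inE => /andP[ezy /orP[/eqP yw|yp]].
    by rewrite -yw ezy inE eqxx !orbT.
  case: (eqVneq y (x_ k.-1)) => [yx|yx]; last by rewrite yp ezy.
  by rewrite -yx ezy inE eqxx !orbT.
apply: leq_trans (subset_leq_card sub) _.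
apply: leq_trans (leq_card_setU _ _) _; rewrite -addn1 leq_add2l.
case: ifP => zw; case: ifP => zk; rewrite ?setU0 ?set0U ?cards1 ?cards0 //.
by case: (nonconsec_cap zR zw zk).
Qed.

Lemma succ_disjoint z a b y : z \in R -> a \in links z -> b \in links z ->
  y \in R -> e (succ a) y -> e (succ b) y -> a = b.
Proof.
move=> zR az bz yR ea eb.
have [ia xa eza] := linksP az; have [ib xb ezb] := linksP bz.
have yz: y != z.
  apply/eqP=> yz; apply: (nonconsec (i := index a p) (z := z)) => //.
    by rewrite xa.
  by rewrite -yz e_sym.
rewrite -xa -xb; case: (ltngtP (index a p) (index b p)) => [lt|lt|->//].
  case: (@reroute (index a p) (index b p) z y); rewrite ?xa ?xb //.
    by rewrite e_sym.
  by rewrite e_sym.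
case: (@reroute (index b p) (index a p) z y); rewrite ?xa ?xb //.
  by rewrite e_sym.
by rewrite e_sym.
Qed.

Lemma insert_path a (u : seq T) z y : k + size u <= m.*2 -> uniq u -> {subset u <= R} ->
  walk e z y u -> a \in links z -> e (succ a) y -> False.
Proof.
move=> le uu su wu az ey; have [ia xa eza] := linksP az.
apply: (@detour (index a p) (index a p).+1 u z y) => //; try arith.
- by rewrite xa e_sym.
- by rewrite e_sym.
- by have:= walk_gt0 wu; arith.
Qed.

Lemma succ_far z a y : z \in R -> a \in links z -> y \in R -> e z y ->
  e (succ a) y -> False.
Proof.
move=> zR az yR zy ay; have kmax := k_max; have k2 := k_ge2.
have zNy: z != y by apply: contraTneq zy => ->; rewrite e_irr.
apply: (@insert_path a [:: z; y] z y) => //=; rewrite ?inE ?zNy //; try arith.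
- by move=> x; rewrite in_cons mem_seq1 => /orP[]/eqP->.
- by rewrite !eqxx zy.
Qed.

(** Common neighbours in [R] of two successors are excluded by [reroute], and
    neighbours shared with [z] by inserting [z] and the shared vertex in [p]. *)
Lemma links_sum z : z \in R ->
  \sum_(a in links z) dR (succ a) <= #|(R :\ z) :\: nb z|.
Proof.
move=> zR; apply: sum_disjoint => [a b y az bz|a az].
  rewrite !inE => /andP[ea yR] /andP[eb _]; apply: (@succ_disjoint z a b y) => //.
  by rewrite !inE.
apply/subsetP=> y; rewrite 2!inE => /andP[ea yR]; rewrite 4!inE yR andbT.
have [ia xa eza] := linksP az.
apply/andP; split; first by apply/negP=> zy; apply: (succ_far zR az yR zy).
apply/eqP=> yz; apply: (nonconsec (i := index a p) (z := z)) => //.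
  by rewrite xa.
by rewrite -yz e_sym.
Qed.

Lemma card_far z : z \in R -> #|(R :\ z) :\: nb z| + dR z + k.+2 = 3 * m.
Proof.
move=> zR; have kmax := k_max.
have cR := card_rest.
have:= cardsD1 z R; rewrite zR /= cR.
have:= cardsID (nb z) (R :\ z).
have ->: (R :\ z) :&: nb z = nb z :&: R.
  apply/setP=> y; rewrite !inE.
  by case: (eqVneq y z) => [->|]; rewrite ?e_irr ?andbF //= andbC.
by rewrite -/(dR z); arith.
Qed.

Lemma pair_links z a b : z \in R -> a \in links z -> b \in links z -> a != b ->
  m.*2 <= k + dR (succ a) + dR (succ b) /\
  (k = m.*2.-2 -> 3 <= dR (succ a) + dR (succ b)).
Proof.
move=> zR az bz ab.
have [ia xa eza] := linksP az; have [ib xb ezb] := linksP bz.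
case: (ltngtP (index a p) (index b p)) => [lt|lt|eq].
- by apply: (pair_deg lt ib zR); rewrite ?xa ?xb.
- have [] := pair_deg lt ia zR; rewrite ?xa ?xb //.
  by rewrite -/(succ a) -/(succ b) -addnA addnC addnAC -addnA (addnC (dR (succ b))); arith.
- by move: ab; rewrite -xa -xb eq eqxx.
Qed.

(** Two of the terms, one of them minimal, add up to [c]; each other term is at
    least half of [c], hence at least two. *)
Lemma links_sum_ge z (c : nat) : z \in R -> 2 <= #|links z| -> 3 <= c ->
  (forall a b, a \in links z -> b \in links z -> a != b ->
     c <= dR (succ a) + dR (succ b)) ->
  c + 2 * (#|links z| - 2) <= \sum_(a in links z) dR (succ a).
Proof.
move=> zR b2 c3 pr.
have [a0 a0z]: exists a, a \in links z by apply/set0Pn; rewrite -card_gt0; arith.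
case: (arg_minnP (fun a => dR (succ a)) a0z) => a az0 amin;
  have az : a \in links z := az0.
have b1: #|links z :\ a| = #|links z|.-1 by rewrite (cardsD1 a (links z)) az.
have [b]: exists b, b \in links z :\ a by apply/set0Pn; rewrite -card_gt0; arith.
rewrite !inE => /andP[ba bz].
have bz': b \in links z by rewrite inE.
rewrite (bigD1 a) //= (bigD1 b) ?bz' //= addnA.
apply: leq_add; first by apply: pr; rewrite // eq_sym.
have ->: 2 * (#|links z| - 2) = \sum_(i in links z :\ a :\ b) 2.
  rewrite sum_nat_const mulnC; congr (_ * _).
  have:= cardsD1 b (links z :\ a); rewrite !inE ba bz b1 /=; arith.
rewrite (eq_bigl (fun i => [&& i \in links z, i != a & i != b])); last first.
  by move=> i; rewrite !in_setD1; case: (i \in links z);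
    rewrite ?andbF ?andbT // andbC.
rewrite [X in _ <= X](eq_bigl (fun i => [&& i \in links z, i != a & i != b]));
  last first.
  by move=> i; rewrite andbA.
apply: leq_sum => i /and3P[iz ia _].
have:= pr i a iz az ia; have:= amin i iz; arith.
Qed.

(** The upper bound [links_sum] and the lower bound [links_sum_ge] leave no room
    for two links, except when all the inequalities are equalities. *)
Lemma links_cases z : z \in R -> #|links z| <= 1 \/
  [/\ #|links z| = 2, dS z = 3, k.+3 <= m.*2, dR z = m - 2 &
      \sum_(a in links z) dR (succ a) = #|(R :\ z) :\: nb z|].
Proof.
move=> zR; case: (leqP #|links z| 1) => b1; [by left | right].
have kmax := k_max; have [zH _ _] := restP zR.
have le1 := dS_links zR; have le2 := links_sum zR; have eq3 := card_far zR.
have dz := deg_split zH.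
case: (ltngtP k m.*2.-2) => [klt|//|keq]; first 1 last.
- by arith.
- have := @links_sum_ge z 3 zR b1 isT.
  move=> /(_ (fun a b az bz ab => proj2 (pair_links zR az bz ab) keq)).
  by arith.
have X a b (az : a \in links z) (bz : b \in links z) (ab : a != b) :
    m.*2 - k <= dR (succ a) + dR (succ b).
  by have:= proj1 (pair_links zR az bz ab); arith.
have h3: 2 < m.*2 - k by arith.
by have Y := links_sum_ge zR b1 h3 X; split; arith.
Qed.

Lemma clique_path (K : {set T}) x s :
  {in K &, forall a b, a != b -> e a b} -> {subset x :: s <= K} ->
  uniq (x :: s) -> path e x s.
Proof.
move=> cl; elim: s x => [|y s IHs] //= x sub /andP[xNs us].
apply/andP; split; last first.
  by apply: IHs => // t ts; apply: sub; rewrite inE ts orbT.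
apply: cl; try by apply: sub; rewrite !inE eqxx ?orbT.
by apply: contraNneq xNs => ->; rewrite mem_head.
Qed.

Lemma clique_walk (K : {set T}) z z' (q : nat) :
  {in K &, forall a b, a != b -> e a b} -> z \in K -> z' \in K -> z != z' ->
  1 < q <= #|K| ->
  exists u, [/\ walk e z z' u, uniq u, {subset u <= K} & size u = q].
Proof.
move=> cl zK z'K zz' /andP[q1 qK].
set E := enum (K :\ z :\ z'); pose s := take (q - 2) E.
have szE: size E = #|K| - 2.
  rewrite -cardE; have := cardsD1 z K; have := cardsD1 z' (K :\ z).
  by rewrite !inE zK z'K eq_sym zz' /=; lia.
have sE y : y \in s -> [/\ y \in K, y != z & y != z'].
  by move/mem_take; rewrite mem_enum !inE => /and3P[].
have us: uniq (z :: rcons s z').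
  rewrite /= mem_rcons rcons_uniq inE negb_or zz' take_uniq ?enum_uniq // andbT.
  by apply/andP; split; apply/negP=> /sE[_ /eqP ? /eqP ?].
have sub: {subset z :: rcons s z' <= K}.
  by move=> y; rewrite inE mem_rcons inE => /or3P[/eqP->|/eqP->|/sE[]].
exists (z :: rcons s z'); split=> //; last first.
  by rewrite /= size_rcons size_takel ?szE; arith.
by rewrite /= eqxx last_rcons eqxx andbT; apply: clique_path cl sub us.
Qed.

(** In a clique the length of a detour can be prescribed exactly. *)
Lemma clique_detour (K : {set T}) z z' i j :
  {in K &, forall a b, a != b -> e a b} -> K \subset R -> #|K| = m.-1 ->
  z \in K -> z' \in K -> z != z' -> i < j -> j < m -> j < k ->
  e z (x_ i) -> e z' (x_ j) -> False.
Proof.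
move=> cl sKR cK zK z'K zz' ij jm jk ezi ezj; have kmax := k_max.
have [|u [wu uu su szu]] := @clique_walk K z z' (maxn 2 (j - i)) cl zK z'K zz'.
  by rewrite cK; arith.
apply: (@detour i j u z z') => //; rewrite ?szu ?ij //; try arith.
- by move=> y /su; apply/subsetP.
- by rewrite e_sym.
Qed.

(** In the boundary case of [links_cases], [z] and its neighbours in [R] form a
    set [K] of [m - 1] vertices without edges to the other vertices of [R]. All
    vertices of [K] are again in the boundary case, so [K] is a clique and two
    of its vertices have different links, between which [K] offers a detour. The
    detour has the right length because [R] also contains a vertex outside [K],
    with its neighbours, so that [k <= m + 1]. *)
Lemma links_le1 z : z \in R -> #|links z| <= 1.
Proof.
move=> zR; case: (links_cases zR) => // -[l2 d3 k3 dR2 eqsum]; exfalso.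
have kmax := k_max; have [zH _ _] := restP zR.
set K := z |: (nb z :&: R).
have cK: #|K| = m.-1.
  by rewrite cardsU1 !inE e_irr /= -/(dR z) dR2; arith.
have sKR: K \subset R by rewrite subUset sub1set zR subsetIr.
have outK y : y \in R -> y \notin K -> exists2 a, a \in links z & e (succ a) y.
  move=> yR yK;
    case: (pickP (fun a => (a \in links z) && e (succ a) y))
    => [a /andP[]|no].
    by exists a.
  have: \sum_(a in links z) dR (succ a) <= #|(R :\ z :\: nb z) :\ y|.
    apply: sum_disjoint => [a b v az bz|a az].
      rewrite 2!inE => /andP[ea vR]; rewrite 2!inE => /andP[eb _].
      exact: (@succ_disjoint z a b v).
    apply/subsetP=> v; rewrite 2!inE => /andP[ea vR].
    rewrite in_setD1 in_setD in_setD1 vR andbT.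
    have [ia xa eza] := linksP az.
    have vz: v != z.
      apply/eqP=> vz; apply: (nonconsec (i := index a p) (z := z)) => //.
        by rewrite xa.
      by rewrite -vz e_sym.
    rewrite vz andbT [v \in nb z]inE; apply/andP; split.
      by apply/eqP=> vy; have:= no a; rewrite az -vy ea.
    by apply/negP=> zv; apply: (succ_far zR az vR zv).
  rewrite eqsum; have:= cardsD1 y (R :\ z :\: nb z).
  move: yK; rewrite in_setU1 in_setI in_setD in_setD1 yR !andbT negb_or => /andP[-> ->] /=.
  by arith.
(* Outside K every vertex of R is adjacent to the successor of a link; an edge
   from K to such a vertex would allow an insertion of three vertices. *)
have closed y y' : y \in K -> y' \in R -> e y y' -> y' \in K.
  move=> yK y'R eyy'; apply: contraT => y'K.
  have [a az eay'] := outK y' y'R y'K.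
  move: (yK); rewrite in_setU1 in_setI => /orP[/eqP yz|/andP[zy yR]].
    by move: y'K; rewrite in_setU1 in_setI y'R andbT inE -yz eyy' orbT.
  exfalso; rewrite inE in zy.
  have zy': z != y' by apply: contraNneq y'K => <-; rewrite setU11.
  have zNy: z != y by apply: contraTneq zy => ->; rewrite e_irr.
  have yNy': y != y' by apply: contraTneq eyy' => ->; rewrite e_irr.
  apply: (@insert_path a [:: z; y; y'] z y') => //=; try arith.
  - by rewrite !inE negb_or zNy zy' yNy'.
  - by move=> v; rewrite !in_cons in_nil orbF => /or3P[]/eqP->.
  - by rewrite !eqxx zy eyy'.
(* With at most m - 2 neighbours in R, y has at least three in S. *)
have Kdeg y : y \in K -> nb y :&: R = K :\ y /\ #|links y| = 2.
  move=> yK; have yR := subsetP sKR y yK; have [yH _ _] := restP yR.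
  have sub: nb y :&: R \subset K :\ y.
    apply/subsetP=> v; rewrite in_setI in_setD1 inE => /andP[yv vR].
    by rewrite (closed y v) // andbT; apply: contraTneq yv => ->; rewrite e_irr.
  have le := subset_leq_card sub.
  have cK1 := cardsD1 y K; rewrite yK cK in cK1.
  have dy := deg_split yH; rewrite -/(dR y) in le.
  have := dS_links yR => dl.
  case: (links_cases yR) => [l1|[ly dy3 _ dRy _]]; first by exfalso; arith.
  split=> //; apply/eqP; rewrite eqEcard sub -/(dR y) dRy; arith.
have cl: {in K &, forall a b, a != b -> e a b}.
  move=> a b aK bK ab; have [eqa _] := Kdeg a aK.
  by have: b \in K :\ a by [rewrite in_setD1 eq_sym ab];
    rewrite -eqa !inE => /andP[].
have cR := card_rest; have k2 := k_ge2.
have cRK: #|R :\: K| = m.*2 - k.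
  by rewrite cardsD (setIidPr sKR) cR cK; arith.
have kle: k <= m.+1.
  have [y]: exists y, y \in R :\: K by apply/set0Pn; rewrite -card_gt0 cRK; arith.
  rewrite in_setD => /andP[yK yR]; have [yH _ _] := restP yR.
  have sub: nb y :&: R \subset (R :\: K) :\ y.
    apply/subsetP=> v; rewrite in_setI in_setD1 in_setD inE => /andP[yv vR].
    rewrite vR andbT; apply/andP; split.
      by apply: contraTneq yv => ->; rewrite e_irr.
    by apply: contraNN yK => vK; apply: (closed v y) => //; rewrite e_sym.
  have le := subset_leq_card sub; rewrite -/(dR y) in le.
  have cK1 := cardsD1 y (R :\: K); rewrite in_setD yK yR cRK /= in cK1.
  have dy := deg_split yH; have dl := dS_links yR.
  by case: (links_cases yR) => [l1|[ly dy3 _ dRy _]]; arith.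
(* The last vertex of p is not a link, so indices of links are below m. *)
have [z']: exists z', z' \in K :\ z.
  apply/set0Pn; rewrite -card_gt0; have := cardsD1 z K.
  by rewrite setU11 cK; arith.
rewrite in_setD1 => /andP[z'z z'K].
have [_ l2'] := Kdeg z' z'K.
have [c cz']: exists c, c \in links z' by apply/set0Pn; rewrite -card_gt0 l2'.
have [a]: exists a, a \in links z :\ c.
  by apply/set0Pn; rewrite -card_gt0; have := cardsD1 c (links z); rewrite l2;
    case: (c \in _); arith.
rewrite in_setD1 => /andP[ac az].
have [ia xa eza] := linksP az; have [ic xc ezc] := linksP cz'.
have zK: z \in K by rewrite setU11.
case: (ltngtP (index a p) (index c p)) => [lt|lt|eq].
- apply: (@clique_detour K z z' (index a p) (index c p)); rewrite ?xa ?xc //;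
  try arith.
  by rewrite eq_sym.
- by apply: (@clique_detour K z' z (index c p) (index a p)); rewrite ?xa ?xc //;
  arith.
- by move: ac; rewrite -xa -xc eq eqxx.
Qed.

Lemma dS_le2 z : z \in R -> dS z <= 2.
Proof. by move=> zR; have := dS_links zR; have := links_le1 zR; arith. Qed.

Lemma dR_ge z : z \in R -> m <= (dR z).+1.
Proof.
move=> zR; have [zH _ _] := restP zR; have := deg_split zH; have := dS_le2 zR;
  arith.
Qed.

Lemma dS2 z : z \in R -> dS z = 2 -> e z w || e z (x_ k.-1).
Proof.
move=> zR d2; apply: contraT; rewrite negb_or => /andP[/negPf zw /negPf zk].
have: dS z <= #|links z|.
  rewrite dSE; apply/subset_leq_card/subsetP=> y; rewrite !inE => /andP[ezy].
  case/orP=> [/eqP yw|yp]; first by rewrite -yw ezy in zw.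
  by rewrite yp ezy; apply: contraFneq zk => <-.
by have := links_le1 zR; arith.
Qed.

End Top.

Lemma dS_rev w p x : dS w (rev p) x = dS w p x.
Proof. by rewrite /dS /= count_rev. Qed.

(** * The remaining part is dense *)

Section Top2.
Variables (w : T) (p : seq T).
Hypothesis top : max_capped w p.
Local Notation k := (size p).
Local Notation R := (rest w p).
Local Notation x_ := (nth w p).

Lemma rev_last : nth w (rev p) (size (rev p)).-1 = x_ 0.
Proof.
by have := k_ge2 top => k2; rewrite size_rev nth_rev; [congr nth|]; arith.
Qed.

Lemma nonconsec_cap0 z : z \in R -> e z w -> e z (x_ 0) -> False.
Proof.
rewrite -rest_rev => zR zw z0.
by apply: (nonconsec_cap (max_capped_rev top) zR zw); rewrite rev_last.
Qed.

(** Apply [dS2] to the capped cycle and to its reversal. *)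
Lemma dS2_ends z : z \in R -> dS w p z = 2 -> ~~ e z w ->
  e z (x_ 0) && e z (x_ k.-1).
Proof.
move=> zR d2 zw; have := dS2 top zR d2; rewrite (negPf zw) /= => ->.
have := @dS2 _ _ (max_capped_rev top) z;
  rewrite rest_rev dS_rev rev_last (negPf zw) /=.
by move=> ->.
Qed.

Definition ball y := y |: (nb y :&: R).

Lemma ball_ge y : y \in R -> m <= #|ball y|.
Proof.
move=> yR; rewrite cardsU1 !inE e_irr /= -/(dR w p y); have := dR_ge top yR; arith.
Qed.

Lemma ball_sub y : y \in R -> ball y \subset R.
Proof. by move=> yR; rewrite subUset sub1set yR subsetIr. Qed.

(** The paths on two or three vertices are the short detours used below. *)
Definition near y y' :=
  exists u, [/\ walk e y y' u, uniq u, {subset u <= R} & 1 < size u <= 3].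

Lemma near1 y y' : y \in R -> y' \in R -> e y y' -> near y y'.
Proof.
move=> yR y'R ey; exists [:: y; y']; rewrite /= !eqxx ey !inE; split=> //.
  by rewrite andbT; apply: contraTneq ey => ->; rewrite e_irr.
by move=> v; rewrite !in_cons in_nil orbF => /orP[]/eqP->.
Qed.

Lemma near_ball y y' : y \in R -> y' \in R -> y != y' ->
  ~~ [disjoint ball y & ball y'] -> near y y'.
Proof.
move=> yR y'R yy'; rewrite -setI_eq0 => /set0Pn[t].
rewrite in_setI !in_setU1 !in_setI !in_set => /andP[].
case: (eqVneq t y) => [->|ty] /=.
  move=> _; rewrite (negPf yy') /= => /andP[e1 _].
  by apply: near1; rewrite // e_sym.
case/andP=> yt tR; case: (eqVneq t y') => [ty'|ty'] /=.
  by move=> _; apply: near1; rewrite // -ty'.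
case/andP=> y't _; exists [:: y; t; y']; split=> //.
- by rewrite /= !eqxx yt e_sym y't.
- by rewrite /= !inE negb_or (eq_sym y t) ty yy' ty'.
by move=> v; rewrite !in_cons in_nil orbF => /or3P[]/eqP-> //; rewrite !inE.
Qed.

Lemma disjoint_balls y y' : y \in R -> y' \in R -> [disjoint ball y & ball y'] ->
  2 * m <= #|R|.
Proof.
move=> yR y'R dis; have := leq_card_setU (ball y) (ball y').
rewrite dis => /leqifP /eqP eqU.
have sub: ball y :|: ball y' \subset R by rewrite subUset !ball_sub.
by have := subset_leq_card sub; have := ball_ge yR; have := ball_ge y'R; arith.
Qed.

Lemma disjoint_balls3 y1 y2 y3 : y1 \in R -> y2 \in R -> y3 \in R ->
  [disjoint ball y1 & ball y2] -> [disjoint ball y2 & ball y3] ->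
  [disjoint ball y1 & ball y3] -> 3 * m <= #|R|.
Proof.
move=> y1R y2R y3R d12 d23 d13.
have := leq_card_setU (ball y1) (ball y2); rewrite d12 => /leqifP /eqP eqU.
have := leq_card_setU (ball y1 :|: ball y2) (ball y3).
have -> : [disjoint ball y1 :|: ball y2 & ball y3].
  by rewrite -setI_eq0 setIUl setU_eq0 !setI_eq0 d13 d23.
move=> /leqifP /eqP eqU3.
have sub: ball y1 :|: ball y2 :|: ball y3 \subset R by rewrite 2!subUset !ball_sub.
have := subset_leq_card sub; have := ball_ge y1R; have := ball_ge y2R.
by have := ball_ge y3R; arith.
Qed.

Lemma next_neq i y y' : i.+1 < k -> y \in R -> e (x_ i) y -> e (x_ i.+1) y' ->
  y != y'.
Proof.
move=> ik yR ey ey'; apply/eqP=> yy'.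
by apply: (nonconsec top yR ik); rewrite e_sym // yy'.
Qed.

Lemma near_step1 i y y' : i.+1 < k -> k.+3 <= m.*2 ->
  e (x_ i) y -> e (x_ i.+1) y' -> near y y' -> False.
Proof.
move=> ik k3 ey ey' [u [wu uu su szu]].
apply: (@detour _ _ top i i.+1 u y y') => //; try arith.
by rewrite e_sym.
Qed.

Lemma near_step2 i y y' : i.+2 < k -> e (x_ i) y -> e (x_ i.+2) y' ->
  near y y' -> False.
Proof.
move=> ik ey ey' [u [wu uu su szu]]; have kmax := k_max top.
apply: (@detour _ _ top i i.+2 u y y') => //; try arith.
by rewrite e_sym.
Qed.

Lemma step_balls_disjoint i y y' : i.+1 < k -> k.+3 <= m.*2 -> y \in R -> y' \in R ->
  e (x_ i) y -> e (x_ i.+1) y' -> [disjoint ball y & ball y'].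
Proof.
move=> ik k3 yR y'R ey ey'; apply: contraT => nd; exfalso.
by apply: (near_step1 ik k3 ey ey' (near_ball yR y'R (next_neq ik yR ey ey') nd)).
Qed.

Lemma dS_le x : x \in w :: p -> dS w p x <= k.
Proof.
move=> xS; rewrite (dSE top); have := cardsD1 x [set y in w :: p].
rewrite (card_wp top) inE xS => -[->]; apply/subset_leq_card/subsetP=> y.
rewrite in_setI in_setD1 [y \in nb x]inE => /andP[exy ->]; rewrite andbT.
by apply: contraTneq exy => ->; rewrite e_irr.
Qed.

Lemma dR_S x : x \in w :: p -> m < k + dR w p x.
Proof. by move=> xS; have := dS_le xS; have := deg_split top (sub_p top xS);
  arith. Qed.

Lemma nbR_neq x (y : T) : 1 < dR w p x -> exists y', [/\ y' \in R, e x y' & y' != y].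
Proof.
move=> d2; have [y']: exists y', y' \in (nb x :&: R) :\ y.
  apply/set0Pn; rewrite -card_gt0; have := cardsD1 y (nb x :&: R).
  by rewrite -/(dR w p x); case: (y \in _); arith.
by rewrite in_setD1 in_setI inE => /and3P[y'y xy' y'R]; exists y'.
Qed.

Lemma nbR x : 0 < dR w p x -> exists2 y, y \in R & e x y.
Proof.
by rewrite card_gt0 => /set0Pn[y]; rewrite in_setI inE => /andP[xy yR]; exists y.
Qed.

Lemma x_in i : i < k -> x_ i \in w :: p.
Proof. by move=> ik; rewrite inE mem_nth ?orbT. Qed.

End Top2.

(** If [k <= m], every vertex of [S] has a neighbour in [R]. Choose such
    neighbours for two consecutive vertices, or even for three when [k < m]. Their
    closed neighbourhoods in [R] have at least [m] elements and are disjoint, as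
    no short detour exists, but [R] has fewer than [2m] or [3m] elements. *)
Lemma max_capped_gt w p : max_capped w p -> m < size p.
Proof.
move=> top; rewrite ltnNge; apply/negP=> km.
have k2 := k_ge2 top; have kmax := k_max top; have cR := card_rest top.
have i0 := @x_in w p 0 _; have i1 := @x_in w p 1 _.
have k0: 0 < size p by arith.
have d0 := dR_S top (i0 k0); have d1 := dR_S top (i1 k2).
have [|y0 y0R ey0] := @nbR w p (nth w p 0); first by arith.
have [|y1 y1R ey1] := @nbR w p (nth w p 1); first by arith.
have k3: (size p).+3 <= m.*2 by arith.
have d01 := step_balls_disjoint top k2 k3 y0R y1R ey0 ey1.
have := disjoint_balls top y0R y1R d01; rewrite cR => le2m.
(* For k = 2 the third vertex is the cap w; the roles in the triangle rotate. *)
case: (ltnP 2 (size p)) => [k2'|k2'].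
  have d2 := dR_S top (x_in w k2').
  have [|y2 [y2R ey2 y20]] := @nbR_neq w p (nth w p 2) y0; first by arith.
  have d12 := step_balls_disjoint top k2' k3 y1R y2R ey1 ey2.
  have d02: [disjoint ball w p y0 & ball w p y2].
    apply: contraT => nd; exfalso; apply: (near_step2 top k2' ey0 ey2).
    by apply: near_ball; rewrite // eq_sym.
  have := disjoint_balls3 top y0R y1R y2R d01 d12 d02; arith.
have dw := dR_S top (mem_head w p).
have [|y2 y2R ey2] := @nbR w p w; first by arith.
case: (cap_ends top) => _; have: size p = 2 by arith.
case: p top {k2 kmax i0 i1 k0 d0 d1 k3 le2m k2' dw km} cR d01 ey0 ey1 y0R y1R y2R ey2
  => [|a [|b [|]]] //= top cR d01 ey0 ey1 y0R y1R y2R ey2 _ eab wa wb.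
have [zH zw zp] : [/\ uniq [:: w; a; b], w \in H & a \in H /\ b \in H].
  have sub := sub_p top; split; [exact: (uniq_wp top) | | split]; apply: sub;
  by rewrite !inE eqxx ?orbT.
move: zp zH => [aH bH]; rewrite /= !inE negb_or !andbT => /andP[/andP[wNa wNb] aNb].
have swap c d v : perm_eq [:: c; d; v] [:: w; a; b] -> e c d -> e c v -> e d v ->
   max_capped c [:: d; v] /\ rest c [:: d; v] = rest w [:: a; b].
  move=> pm cd cv dv; split.
    apply: (max_capped_eq top) => //; apply: (@cappedI _ _ d v) => //.
    - by rewrite /= !eqxx dv.
    - by rewrite (perm_uniq pm) /= !inE negb_or wNa wNb aNb.
    - by move=> x; rewrite (perm_mem pm) !inE => /or3P[]/eqP->.
  by apply/setP=> x; rewrite !in_setD !in_set (perm_mem pm).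
have k3: 5 <= m.*2 by arith.
have [topa eqa]: max_capped a [:: b; w] /\ rest a [:: b; w] = rest w [:: a; b].
  by apply: swap; rewrite // 1?e_sym // (perm_catC [:: a; b] [:: w]).
have [topb eqb]: max_capped b [:: a; w] /\ rest b [:: a; w] = rest w [:: a; b].
  by apply: swap; rewrite // 1?e_sym // (perm_rev [:: w; a; b]).
have d12: [disjoint ball w [:: a; b] y1 & ball w [:: a; b] y2].
  by have := @step_balls_disjoint _ _ topa 0 y1 y2; rewrite /ball eqa; apply.
have d02: [disjoint ball w [:: a; b] y0 & ball w [:: a; b] y2].
  by have := @step_balls_disjoint _ _ topb 0 y0 y2; rewrite /ball eqb; apply.
by have := disjoint_balls3 top y0R y1R y2R d01 d12 d02; arith.
Qed.

(** * Few vertices have two neighbours in the other part *)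

Section Top3.
Variables (w : T) (p : seq T).
Hypothesis top : max_capped w p.
Local Notation k := (size p).
Local Notation R := (rest w p).
Local Notation x_ := (nth w p).

(** Closed neighbourhoods in [R] have at least [m] elements, and [R] has at most
    [2m - 2]. *)
Lemma near_all y y' : y \in R -> y' \in R -> y != y' -> near w p y y'.
Proof.
move=> yR y'R yy'; apply: near_ball => //;
  apply/negP=> /(disjoint_balls top yR y'R).
by have := card_rest top; have := max_capped_gt top; have := k_max top; arith.
Qed.

(** At distance one or two along [p], a short detour would enlarge the cycle.
    Only at distance one with [k = 2m - 2] is the detour through three vertices
    too long; then [R] is so dense that one through two vertices exists. *)
Lemma busy_gap i j : i < j < k -> 1 < dR w p (x_ i) -> 1 < dR w p (x_ j) -> i + 3 <= j.
Proof.
case/andP=> ij jk di dj; rewrite leqNgt; apply/negP=> ji.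
have kmax := k_max top; have kgt := max_capped_gt top.
have [|y yR ey] := @nbR w p (x_ i); first by arith.
case: (eqVneq j i.+1) => [ej|nj].
  move: jk dj; rewrite ej => ik dj {ij ji ej}.
  case: (leqP k.+3 m.*2) => [k3|k3].
    have [y' y'R ey'] := nbR (ltnW dj).
    exact: (near_step1 top ik k3 ey ey' (near_all yR y'R (next_neq top ik yR ey ey'))).
  have cR := card_rest top.
  have [y' yy']: exists y', y' \in ball w p y :&: (nb (x_ i.+1) :&: R).
    apply/set0Pn; rewrite -card_gt0.
    have := cardsUI (ball w p y) (nb (x_ i.+1) :&: R).
    have sub: ball w p y :|: (nb (x_ i.+1) :&: R) \subset R.
      by rewrite subUset ball_sub // subsetIr.
    have := subset_leq_card sub; have := ball_ge top yR.
    by rewrite -/(dR w p (x_ i.+1)); arith.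
  move: yy'; rewrite in_setI in_setU1 !in_setI inE [y' \in nb (x_ _)]inE.
  case/andP=> y'y /andP[ey' y'R].
  have y'Ny := next_neq top ik yR ey ey'; move: y'y; rewrite eq_sym (negPf y'Ny) /=.
  case/andP=> eyy' _; apply: (@detour _ _ top i i.+1 [:: y; y'] y y') => //.
  - by rewrite ltnSn.
  - by rewrite /= !eqxx eyy'.
  - by rewrite /= inE y'Ny.
  - by move=> v; rewrite !in_cons in_nil orbF => /orP[]/eqP->.
  - by rewrite e_sym.
  - by rewrite subSnn.
  - by rewrite /=; arith.
have ej: j = i.+2 by move/eqP: nj => nj; arith.
move: jk dj; rewrite ej => ik dj.
have [y' [y'R ey' y'y]] := nbR_neq y dj.
by apply: (near_step2 top ik ey ey' (near_all yR y'R _)); rewrite eq_sym.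
Qed.

(** When [m = 3] and [k = 4], [busy_gap] still allows both ends of [p] to be busy,
    besides [w]. A path on two vertices between neighbours of the ends closes [p]
    to a hexagon; one on three vertices forms a hexagon with [w] and the ends. *)
Lemma busy_ends : k = 4 -> m = 3 -> 1 < dR w p (x_ 0) -> 1 < dR w p (x_ 3) -> False.
Proof.
move=> k4 m3 d0 d3; have [wp e0 w0 wk] := cap_ends top; rewrite k4 /= in wp e0 wk.
have [y yR ey] := nbR (ltnW d0); have [y' [y'R ey' y'y]] := nbR_neq y d3.
have [|u [wu uu su szu]] := near_all yR y'R; first by rewrite eq_sym.
have uS v : v \in u -> v \notin w :: p.
  by move=> /su/(restP)[_ vw vp]; rewrite inE negb_or vw.
have uH v : v \in u -> v \in H by move=> /su/restP[].
apply: noC; rewrite m3.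
have /orP[/eqP sz|/eqP sz] : (size u == 2) || (size u == 3) by arith.
  apply: (@has_cycleI _ (x_ 0) y (p ++ rev u)).
  - by apply: (walk_cat wp (walk_rev e_sym wu)).
  - by rewrite e_sym.
  - rewrite cat_uniq rev_uniq uu andbT; have := uniq_wp top => /= /andP[_ ->].
    apply/hasPn=> v; rewrite mem_rev => /uS; rewrite inE negb_or => /andP[_].
    by [].
  - move=> v; rewrite mem_cat mem_rev => /orP[vp|/uH//].
    by apply: (sub_p top); rewrite inE vp orbT.
  by rewrite size_cat size_rev sz k4.
have x0: x_ 0 \in p by rewrite mem_nth ?k4.
have x3: x_ 3 \in p by rewrite mem_nth ?k4.
have pNu v : v \in w :: p -> v \notin u by apply: contraL => /uS.
have x03: x_ 0 != x_ 3.
  by apply/eqP => /(x_inj top); rewrite k4 => /(_ isT isT).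
have wN v : v \in p -> w != v.
  by move=> vp; have := uniq_wp top => /= /andP[wp' _]; apply: contraNneq wp' => ->.
apply: (@has_cycleI _ (x_ 0) w (x_ 0 :: u ++ [:: x_ 3; w])).
- apply: (walk_cons ey); apply: (walk_cat wu (c := x_ 3)); last by rewrite e_sym.
  by rewrite /= !eqxx e_sym wk.
- by [].
- rewrite cons_uniq cat_uniq uu mem_cat !inE !negb_or x03 eq_sym wN //=.
  by rewrite !inE !pNu ?inE ?eqxx ?x0 ?x3 ?orbT //= eq_sym wN.
- move=> v; rewrite inE mem_cat !inE.
  by case/or4P=> [/eqP->|/uH//|/eqP->|/eqP->]; apply: (sub_p top);
    rewrite inE ?x0 ?x3 ?eqxx ?orbT.
- by rewrite /= size_cat sz.
Qed.

Definition busy := [set x in w :: p | 1 < dR w p x].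

Lemma card_busy : #|busy| < m.
Proof.
have kmax := k_max top; have kgt := max_capped_gt top.
pose Bp := [set x in p | 1 < dR w p x].
have sub: busy \subset w |: Bp.
  by apply/subsetP=> x; rewrite !inE => /andP[/orP[->//|->] ->]; rewrite orbT.
have le: #|busy| <= #|Bp|.+1.
  apply: leq_trans (subset_leq_card sub) _; rewrite cardsU1.
  by case: (_ \notin _).
have inB x : x \in Bp -> [/\ index x p < k, x_ (index x p) = x & 1 < dR w p x].
  by rewrite inE => /andP[xp dx]; rewrite index_mem nth_index.
have far x y : x \in Bp -> y \in Bp -> index x p < index y p ->
    index x p + 3 <= index y p.
  move=> /inB[ix xx dx] /inB[iy yy dy] lt.
  by apply: busy_gap; [rewrite lt | rewrite xx | rewrite yy].
pose f x : 'I_((k.-1 %/ 3).+1) := inord (index x p %/ 3).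
have finj: {in Bp &, injective f}.
  move=> x y xB yB /(congr1 val) /=.
  have [ix xx _] := inB x xB; have [iy yy _] := inB y yB.
  rewrite !inordK; try by rewrite ltnS leq_div2r //; arith.
  case: (ltngtP (index x p) (index y p)) => [lt|lt|eqi _].
  - by have := far x y xB yB lt; arith.
  - by have := far y x yB xB lt; arith.
  - by rewrite -xx -yy eqi.
have leB: #|Bp| <= (k.-1 %/ 3).+1.
  by rewrite -(card_in_imset finj) -[X in _ <= X]card_ord max_card.
case: (leqP 4 m) => [m4|m3]; first by arith.
have m_3: m = 3 by arith.
have k4: k = 4 by arith.
suff: #|Bp| <= 1 by arith.
rewrite leqNgt; apply/negP=> /card_gt1P[x [y [xB yB xy]]].
have [ix xx dx] := inB x xB; have [iy yy dy] := inB y yB.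
case: (ltngtP (index x p) (index y p)) => [lt|lt|eqi].
- have le3 := far x y xB yB lt.
  apply: busy_ends => //.
    by have e1: index x p = 0 by [arith]; rewrite e1 in xx; rewrite xx.
  by have e1: index y p = 3 by [arith]; rewrite e1 in yy; rewrite yy.
- have le3 := far y x yB xB lt.
  apply: busy_ends => //.
    by have e1: index y p = 0 by [arith]; rewrite e1 in yy; rewrite yy.
  by have e1: index x p = 3 by [arith]; rewrite e1 in xx; rewrite xx.
- by move: xy; rewrite -xx -yy eqi eqxx.
Qed.

(** Every vertex of [R] has at least [m - 1] neighbours in [R]. *)
Lemma greedy_step y (u : seq T) : uniq u -> {subset u <= R} -> y \in u -> size u < m ->
  exists v, [/\ v \in R, e y v & v \notin u].
Proof.
move=> uu su yu szu; have yR := su y yu.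
have [v]: exists v, v \in (nb y :&: R) :\: [set t in u].
  apply/set0Pn; rewrite -card_gt0.
  have sub: (nb y :&: R) :&: [set t in u] \subset [set t in u] :\ y.
    apply/subsetP=> t;
      rewrite in_setI in_setD1 in_setI [t \in nb y]inE => /andP[/andP[yt _] ->].
    by rewrite andbT; apply: contraTneq yt => ->; rewrite e_irr.
  have := subset_leq_card sub; have := cardsD1 y [set t in u].
  have -> : #|[set t in u]| = size u by rewrite cardsE (card_uniqP uu).
  rewrite inE yu; have := cardsID [set t in u] (nb y :&: R).
  by rewrite -/(dR w p y); have := dR_ge top yR; arith.
rewrite in_setD in_setI [v \in nb y]inE inE => /andP[vu /andP[yv vR]].
by exists v.
Qed.

Lemma greedy_path z (q : nat) : z \in R -> 0 < q <= m ->
  exists y u, [/\ walk e z y u, uniq u, {subset u <= R} & size u = q].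
Proof.
move=> zR; elim: q => [//|q IHq] /andP[_ qm].
case: (posnP q) => [->|q0].
  by exists z, [:: z]; rewrite /= !eqxx; split=> // v; rewrite mem_seq1 => /eqP->.
have [|y [u [wu uu su szu]]] := IHq; first by rewrite q0 ltnW.
have [|v [vR yv vu]] := greedy_step uu su (walk_mem_r wu); first by rewrite szu.
exists v, (rcons u v); split.
- exact: walk_rcons wu yv.
- by rewrite rcons_uniq vu.
- by move=> t; rewrite mem_rcons in_cons => /orP[/eqP->|/su].
- by rewrite size_rcons szu.
Qed.

(** Otherwise [z] caps the cycle obtained from [p] by adding [z']. *)
Lemma ends_nonadj z z' : z \in R -> z' \in R -> e z z' ->
  e z (x_ k.-1) -> e z' (x_ 0) -> e z' (x_ k.-1) -> False.
Proof.
move=> zR z'R zz' zk z'0 z'k; have [wp e0 w0 wk] := cap_ends top.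
have [zH zw zp] := restP zR; have [z'H z'w z'p] := restP z'R.
have kmax := k_max top; have kgt := max_capped_gt top.
apply: (max_maximal top (w' := z) (p' := z' :: p)); rewrite ?ltnSn //=;
  last by arith.
apply: (cappedI (walk_cons z'0 wp)) => //.
- have := uniq_wp top; rewrite /= inE negb_or zp z'p => /andP[_ ->]; rewrite !andbT.
  by apply: contraTneq zz' => ->; rewrite e_irr.
- by move=> v; rewrite !in_cons => /or3P[/eqP->|/eqP->|vp] //;
  apply: (sub_p top); rewrite inE vp orbT.
Qed.

(** With the last vertex of [p] as the new cap, follow [p] from its start to
    [x_ i], go over to [z], continue greedily in [R] and return to [w], which is
    adjacent to both the start of [p] and the cap. A vertex of [R] at which the
    return is impossible is adjacent to both ends of [p], and two such vertices
    are not adjacent, so at most one further step is needed. *)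
Lemma not_all_two_half z i : (forall y, y \in R -> dS w p y = 2) ->
  z \in R -> e z w -> 0 < i -> i < k.-1 -> k.-1 <= i.*2 -> e z (x_ i) -> False.
Proof.
move=> all2 zR zw i0 ik ik2 zi; have [wp e0 w0 wk] := cap_ends top.
have kmax := k_max top; have kgt := max_capped_gt top.
have ik': i < k by arith.
have finish (u : seq T) y : walk e z y u -> uniq u -> {subset u <= R} -> e y w ->
    k <= i.+1 + size u < m.*2 -> False.
  move=> wu uu su yw /andP[le1 le2].
  have sz: size (take i.+1 p ++ u ++ [:: w]) = i.+1 + size u + 1.
    by rewrite !size_cat size_takel ?addnA.
  have xk: x_ k.-1 \notin take i.+1 p.
    apply/negP=> /(nthP w)[j]; rewrite size_takel // ltnS => ji.
    by rewrite nth_take // => /(x_inj top) eqj; have: j = k.-1 by [apply: eqj;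
      arith]; arith.
  have up: uniq p by have := uniq_wp top => /= /andP[].
  apply: (max_maximal top (w' := x_ k.-1) (p' := take i.+1 p ++ u ++ [:: w])).
  - apply: (@cappedI _ _ (x_ 0) w) => //.
    + apply: (walk_cat (walk_take w wp ik')); last by rewrite e_sym; exact: zi.
      by apply: (walk_cat wu (walk1 e w)).
    + have kk: k.-1 < k by arith.
      have xkp: x_ k.-1 \in p := mem_nth w kk.
      have wNp: w \notin p by have := uniq_wp top => /= /andP[].
      have xkw: x_ k.-1 != w by apply: contraNneq wNp => <-.
      rewrite cons_uniq !mem_cat inE !negb_or xk xkw andbT /=.
      apply/andP; split; first by apply/negP=> /su/restP[_ _]; rewrite xkp.
      rewrite cat_uniq take_uniq // cat_uniq uu /= !orbF andbT.
      apply/andP; split; last by apply/negP=> /su/restP[_]; rewrite eqxx.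
      apply/hasPn=> v; rewrite mem_cat mem_seq1 => /orP[/su/restP[_ _]|/eqP->].
        by apply: contraNN => /mem_take.
      by apply: contraNN wNp => /mem_take.
    + have xkH: x_ k.-1 \in H by apply: (sub_p top); rewrite x_in //; arith.
      move=> v; rewrite in_cons !mem_cat mem_seq1.
      case/or4P=> [/eqP->|/mem_take vp|/su/restP[]|/eqP->] //; apply: (sub_p top).
        by rewrite inE vp orbT.
      exact: mem_head.
    + by rewrite e_sym.
    + by rewrite e_sym.
    + by rewrite e_sym.
  - by rewrite sz; arith.
  - by rewrite sz; arith.
have [|y [u [wu uu su szu]]] := @greedy_path z (k.-1 - i) zR; first by arith.
have yR: y \in R by apply/su/(walk_mem_r wu).
case yw: (e y w); first by apply: (finish u y) => //; rewrite szu; arith.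
have [|v [vR yv vu]] := greedy_step uu su (walk_mem_r wu).
  by rewrite szu; arith.
have /andP[y0 yk] := dS2_ends top yR (all2 y yR) (negbT yw).
case vw: (e v w).
  apply: (finish (rcons u v) v) => //.
  - exact: walk_rcons wu yv.
  - by rewrite rcons_uniq vu.
  - by move=> t; rewrite mem_rcons in_cons => /orP[/eqP->|/su//].
  - by rewrite size_rcons szu; arith.
have /andP[v0 vk] := dS2_ends top vR (all2 v vR) (negbT vw).
exact: (ends_nonadj yR vR yv yk v0 vk).
Qed.

End Top3.
(** Some vertex of [R] is adjacent to [w]; its other neighbour in [S] lies in one
    of the two halves of [p], and reversing [p] exchanges these. *)
Lemma not_all_two w p : max_capped w p ->
  (forall y, y \in rest w p -> dS w p y = 2) -> False.
Proof.
move=> top all2; have kmax := k_max top; have kgt := max_capped_gt top.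
have cR := card_rest top.
have [z0 z0R]: exists z0, z0 \in rest w p by apply/set0Pn; rewrite -card_gt0; arith.
have s0: {subset [:: z0] <= rest w p} by move=> v; rewrite mem_seq1 => /eqP->.
have [|z1 [z1R z01 _]] := greedy_step top (erefl : uniq [:: z0]) s0 (mem_head _ _).
  by rewrite /=; arith.
have [z zR zw]: exists2 z, z \in rest w p & e z w.
  case z0w: (e z0 w); first by exists z0.
  case z1w: (e z1 w); first by exists z1.
  have /andP[_ z0k] := dS2_ends top z0R (all2 z0 z0R) (negbT z0w).
  have /andP[z10 z1k] := dS2_ends top z1R (all2 z1 z1R) (negbT z1w).
  by case: (ends_nonadj top z0R z1R z01 z0k z10 z1k).
have [a ap za]: exists2 a, a \in p & e z a.
  apply/hasP; rewrite has_count; have := all2 z zR.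
  by rewrite /dS /= zw add1n => -[->].
have ik: index a p < size p by rewrite index_mem.
have xa: nth w p (index a p) = a by rewrite nth_index.
have i0: 0 < index a p.
  rewrite lt0n; apply/eqP=> i0; apply: (nonconsec_cap0 top zR zw).
  by rewrite -i0 xa.
have iN: index a p < (size p).-1.
  rewrite ltn_neqAle; apply/andP; split; last by arith.
  by apply/eqP=> ie; apply: (nonconsec_cap top zR zw); rewrite -ie xa.
case: (leqP (size p).-1 (index a p).*2) => [le|lt].
  by apply: (not_all_two_half top all2 zR zw i0 iN le); rewrite xa.
apply: (@not_all_two_half _ _ (max_capped_rev top) z ((size p).-1 - index a p)).
- by move=> y; rewrite rest_rev dS_rev; apply: all2.
- by rewrite rest_rev.
- by [].
- by arith.
- by rewrite size_rev; arith.
- by rewrite size_rev; arith.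
rewrite nth_rev; last by arith.
by have ->: size p - ((size p).-1 - index a p).+1 = index a p; [arith | rewrite xa].
Qed.

Lemma max_capped_exists a b c : a \in H -> b \in H -> c \in H ->
  e a b -> e b c -> e a c -> exists w p, max_capped w p.
Proof.
move=> aH bH cH ab bc ac.
pose P k := (k <= m.*2.-2) && [exists w : T, [exists p : k.-tuple T, capped w p]].
have P2: P 2.
  apply/andP; split; first by arith.
  apply/existsP; exists c; apply/existsP; exists [tuple a; b].
  apply: (@cappedI _ _ a b) => //.
  - by rewrite /= !eqxx ab.
  - rewrite /= !inE negb_or !andbT; apply/andP; split; first (apply/andP; split).
    + by apply: contraTneq ac => ->; rewrite e_irr.
    + by apply: contraTneq bc => ->; rewrite e_irr.
    + by apply: contraTneq ab => ->; rewrite e_irr.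
  - by move=> x; rewrite !inE => /or3P[]/eqP->.
  - by rewrite e_sym.
  - by rewrite e_sym.
have bound k : P k -> k <= m.*2.-2 by case/andP.
case: (ex_maxnP (ex_intro _ 2 P2) bound) => k /andP[kle /existsP[w /existsP[p cap]]] kmax.
exists w, p; have szp := size_tuple p.
split=> //; rewrite szp // => w' p' cap' lt le.
case: (leqP (size p') m.*2.-2) => [le'|gt].
  suff: size p' <= k by rewrite leqNgt lt.
  apply: kmax; rewrite /P le'; apply/existsP; exists w'.
  by apply/existsP; exists (in_tuple p').
have [a' [b' [wp up sub ab' /andP[wa wb]]]] := cappedP cap'.
apply: noC; have [sz|sz]: size p' = m.*2.-1 \/ size p' = m.*2 by arith.
  apply: (@has_cycleI _ w' b' (w' :: p')) => //; last by rewrite /=; arith.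
    exact: walk_cons wa wp.
  by rewrite e_sym.
apply: (has_cycleI wp) => //; first by rewrite e_sym.
  by case/andP: up.
by move=> x xp; apply: sub; rewrite inE xp orbT.
Qed.

Lemma splitting_of_triangle a b c : a \in H -> b \in H -> c \in H ->
  e a b -> e b c -> e a c ->
  exists S, sparse_split S.
Proof.
move=> aH bH cH ab bc ac; have [w [p top]] := max_capped_exists aH bH cH ab bc ac.
exists [set x in w :: p]; split.
- exact: wp_subH top.
- by rewrite (card_wp top); have := max_capped_gt top; have := k_max top; arith.
- by move=> z zR; rewrite -(dSE top); apply: dS_le2.
- case: (pickP (fun y => (y \in rest w p) && (dS w p y <= 1))) => [u /andP[uR d1]|no].
    by exists u; [exact: uR | rewrite -(dSE top)].
  exfalso; apply: (not_all_two top) => y yR.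
  by have := no y; rewrite yR /=; have := dS_le2 top yR; case: ltngtP; arith.
have := card_busy top; rewrite /busy.
by congr (_ < _); apply: eq_card => x; rewrite !inE.
Qed.

(** * Independent sets of size m *)

Section Alternating.
Variable U : {set T}.
Hypothesis UH : U \subset H.
Hypothesis cardU : #|U| = m.
Hypothesis indU : {in U &, forall x y, ~~ e x y}.

Definition alt x y := e x y && ((x \in U) != (y \in U)).

Lemma alt_sym : symmetric alt.
Proof. by move=> x y; rewrite /alt e_sym eq_sym. Qed.

Lemma altU x y : x \in U -> alt x y = e x y.
Proof.
move=> xU; rewrite /alt xU; case exy: (e x y) => //=.
by case yU: (y \in U) => //; rewrite (negPf (indU xU yU)) in exy.
Qed.

Record alt_cycle (c : seq T) (j : nat) : Prop := AltCycle {
  alt_cyc : cycle alt c;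
  alt_uniq : uniq c;
  alt_sub : {subset c <= H};
  alt_size : size c = j.*2;
  alt_U : count (mem U) c = j }.

Lemma alt_cycleI a b (c : seq T) (j : nat) : walk alt a b c -> alt b a -> uniq c ->
  {subset c <= H} -> size c = j.*2 -> count (mem U) c = j -> alt_cycle c j.
Proof. by move=> wc ba; split=> //; apply: walk_cycle ba. Qed.

Lemma alt_rot c j d : alt_cycle c j -> d \in c ->
  exists c1, [/\ alt_cycle c1 j, walk alt (next c d) d c1, perm_eq c1 c
    & next c1 =1 next c].
Proof.
case=> cyc uc sc szc cU dc; pose n := (index d c).+1.
have pm: perm_eq (rot n c) c by rewrite perm_rot.
have nx: next (rot n c) =1 next c by apply: next_rot.
exists (rot n c); split=> //.
  split; rewrite ?rot_cycle ?rot_uniq ?size_rot ?(permP pm) //.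
  by move=> x; rewrite mem_rot => /sc.
have ld: last d (rot n c) = d.
  have lt: index d c < size c by rewrite index_mem.
  by rewrite /rot last_cat (take_nth d lt) last_rcons nth_index.
have cyc1: cycle alt (rot n c) by rewrite rot_cycle.
have u1: uniq (rot n c) by rewrite rot_uniq.
rewrite -nx; case: (rot n c) pm ld cyc1 u1 => [|x s] pm ld cyc1 u1.
  by move: dc; rewrite -(perm_mem pm).
have ps: path alt x s by move: cyc1; rewrite /= rcons_path => /andP[].
have nxd: next (x :: s) d = x.
  rewrite -ld [last d _]/(last x s) next_nth mem_last (index_last u1).
  by rewrite nth_default.
by rewrite nxd /= eqxx ps -[last x s]/(last d (x :: s)) ld eqxx.
Qed.

(** A special case of a theorem of Jackson on long cycles in bipartite graphs:
    an alternating cycle with [1 < j < m] vertices in [U] can be enlarged. *)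

Section Grow.
Variables (c : seq T) (j : nat).
Hypothesis ac : alt_cycle c j.
Hypothesis j_ge2 : 1 < j.
Hypothesis j_lt : j < m.
Hypothesis stuck : forall c', ~ alt_cycle c' j.+1.

Let free := H :\: (U :|: [set x in c]).

Lemma freeP q : q \in free -> [/\ q \in H, q \notin U & q \notin c].
Proof. by rewrite !inE negb_or -andbA => /and3P[]. Qed.

Lemma card_cU : #|U :&: [set x in c]| = j.
Proof.
rewrite -[RHS](alt_U ac) -(card_nbr_seq (mem U) (alt_uniq ac)).
by apply: eq_card => x; rewrite !inE.
Qed.

Lemma card_c : #|[set x in c]| = j.*2.
Proof. by rewrite cardsE (card_uniqP (alt_uniq ac)) (alt_size ac). Qed.

Lemma card_free : #|free| = m.*2 - j.
Proof.
have sub: U :|: [set x in c] \subset H.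
  by rewrite subUset UH; apply/subsetP=> x; rewrite inE => /(alt_sub ac).
rewrite cardsD (setIidPr sub) cardH; have := cardsUI U [set x in c].
by rewrite card_cU card_c cardU => eqU; arith.
Qed.

Lemma deg_free x : x \in U ->
  m < #|nb x :&: free| + #|nb x :&: [set y in c]|.
Proof.
move=> xU; apply: leq_trans (degH (subsetP UH x xU)) _.
rewrite -(cardsID [set y in c] (nb x :&: H)) addnC; apply: leq_add.
  apply/subset_leq_card/subsetP=> y; rewrite !inE => /and3P[yc xy yH].
  by rewrite xy yH (negPf yc) orbF andbT; apply: contraL xy => yU; apply: indU.
by apply/subset_leq_card/subsetP=> y; rewrite !inE => /andP[/andP[-> _] ->].
Qed.

Lemma deg_c x : x \in U -> #|nb x :&: [set y in c]| <= j.
Proof.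
move=> xU.
have: #|nb x :&: [set y in c]| <= #|[set y in c] :\: U|.
  apply/subset_leq_card/subsetP=> y; rewrite !inE => /andP[xy ->]; rewrite andbT.
  by apply: contraL xy => yU; apply: indU.
have := cardsID U [set y in c]; rewrite setIC card_cU card_c; arith.
Qed.

Lemma alt_next x : x \in c -> alt x (next c x).
Proof. exact: next_cycle (alt_cyc ac). Qed.

Lemma next_U x : x \in c -> x \notin U -> next c x \in U.
Proof. by move=> xc /negPf xU; have /andP[_] := alt_next xc; rewrite xU;
  case: (_ \in U). Qed.

Lemma next_nU x : x \in c -> x \in U -> next c x \notin U.
Proof. by move=> xc xU; have /andP[_] := alt_next xc; rewrite xU;
  case: (_ \in U). Qed.

Variable z : T.
Hypothesis zU : z \in U.
Hypothesis zc : z \notin c.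

Lemma zfree : z \notin free. Proof. by rewrite !inE zU. Qed.

(** Insert [z] and [q] after [d]. *)
Lemma alt_insert d q : d \in c -> e z d -> q \in free -> e z q ->
  e (next c d) q -> False.
Proof.
move=> dc zd qf zq nq; have [qH qU qc] := freeP qf.
have dU: d \notin U by apply: contraL zd => dU; apply: indU.
have [c1 [a1 w1 pm nx]] := alt_rot ac dc.
apply: (@stuck (c1 ++ [:: z; q])); apply: (@alt_cycleI (next c d) q).
- apply: (walk_cat w1 (c := z)); first by rewrite /= !eqxx altU // zq.
  by rewrite alt_sym altU.
- by rewrite alt_sym altU ?next_U.
- rewrite cat_uniq (alt_uniq a1) /= !(perm_mem pm) !inE.
  rewrite (negPf zc) (negPf qc) /= andbT.
  by apply/eqP=> zq'; move: zfree; rewrite zq' ?qf ?q'f.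
- by move=> x; rewrite mem_cat !inE => /or3P[/(alt_sub a1)|/eqP->|/eqP->] //;
  apply: (subsetP UH).
- by rewrite size_cat (alt_size a1) /=; arith.
- by rewrite count_cat (alt_U a1) /= zU (negPf qU); arith.
Qed.

(** The analogue of [reroute] for alternating cycles. *)
Lemma alt_reroute d d' q : d \in c -> d' \in c -> d != d' -> e z d -> e z d' ->
  q \in free -> e (next c d) q -> e (next c d') q -> False.
Proof.
move=> dc d'c dd' zd zd' qf nq nq'; have [qH qU qc] := freeP qf.
have dU: d \notin U by apply: contraL zd => dU; apply: indU.
have d'U: d' \notin U by apply: contraL zd' => d'U; apply: indU.
have [c1 [a1 w1 pm nx]] := alt_rot ac d'c.
have dc1: d \in c1 by rewrite (perm_mem pm).
have ic: index d c1 < size c1 by rewrite index_mem.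
have xd: nth z c1 (index d c1) = d by rewrite nth_index.
have ic': (index d c1).+1 < size c1.
  rewrite ltn_neqAle ic andbT; apply: contraNneq dd' => eqs.
  by rewrite -xd -(walk_nth_last z w1) -eqs.
have xd': nth z c1 (index d c1).+1 = next c d.
  rewrite -nx next_nth dc1; case: (c1) dc1 ic' => // x s _ lt.
  by rewrite /= (set_nth_default x).
have wt := walk_take z w1 ic; rewrite xd in wt.
have wd := walk_drop z w1 ic'; rewrite xd' in wd.
have pm': perm_eq (take (index d c1).+1 c1 ++ (z :: rev (drop (index d c1).+1 c1)) ++ [:: q])
    (z :: q :: c1).
  apply/permP=> P; rewrite /= -{5}(cat_take_drop (index d c1).+1 c1).
  rewrite !count_cat /= !count_cat count_rev /=; arith.
apply: (@stuck (take (index d c1).+1 c1 ++ (z :: rev (drop (index d c1).+1 c1)) ++ [:: q])).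
apply: (@alt_cycleI (next c d') q).
- apply: (walk_cat wt (c := z)); last by rewrite alt_sym altU.
  apply: (walk_cat (walk_cons _ (walk_rev alt_sym wd)) (walk1 alt q)).
    by rewrite altU.
  by rewrite altU ?next_U.
- by rewrite alt_sym altU ?next_U.
- rewrite (perm_uniq pm') /= inE !(perm_mem pm) (negPf zc) qc orbF (alt_uniq a1) !andbT.
  by apply/eqP=> zq'; move: zfree; rewrite zq' ?qf ?q'f.
- move=> x; rewrite (perm_mem pm') !inE => /or3P[/eqP->|/eqP->|/(alt_sub a1)] //.
  exact: (subsetP UH).
- by rewrite (perm_size pm') /= (alt_size a1); arith.
- by rewrite (permP pm') /= (alt_U a1) zU (negPf qU); arith.
Qed.

(** Replace the vertex that follows [u] by [q], [z] and [q']. *)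
Lemma alt_replace u q q' : u \in c -> u \in U -> q \in free -> q' \in free ->
  q != q' -> e u q -> e z q -> e z q' -> e (next c (next c u)) q' -> False.
Proof.
move=> uc uU qf q'f qq' uq zq zq' nq'.
have [qH qU qc] := freeP qf; have [q'H q'U q'c] := freeP q'f.
have [c1 [a1 w1 pm nx]] := alt_rot ac uc.
have wU: next c u \notin U by apply: next_nU.
have wc: next c u \in c by rewrite mem_next.
have nU: next c (next c u) \in U by apply: next_U.
have [s defc1]: exists s, c1 = [:: next c u, next c (next c u) & s].
  have := alt_size a1; have := alt_uniq a1; have := nx (next c u).
  case: c1 w1 {a1 pm nx} => [|x [|y s]] //=; try by move=> *; arith.
  move=> /and3P[/eqP-> _ _] eqn _ _; exists s; congr [:: _, _ & _].
  by rewrite -eqn eqxx.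
have := a1; move: w1 pm; rewrite defc1 => w1 pm a1'.
have ws: walk alt (next c (next c u)) u (next c (next c u) :: s).
  by move: w1; rewrite /= => /and3P[_ /andP[_ ->] ->]; rewrite eqxx.
apply: (@stuck ((next c (next c u) :: s) ++ [:: q; z; q'])).
have inc x : x \in next c (next c u) :: s -> x \in c.
  by move=> xs; rewrite -(perm_mem pm) inE xs orbT.
have us: uniq (next c (next c u) :: s) by have /= /andP[_] := alt_uniq a1'.
apply: (@alt_cycleI (next c (next c u)) q').
- apply: (walk_cat ws (c := q)); last by rewrite altU.
  by rewrite /= !eqxx alt_sym !altU // zq zq'.
- by rewrite alt_sym altU.
- rewrite cat_uniq us andTb; apply/andP; split.
    apply/hasPn=> x; rewrite !inE => xq; apply/negP=> /inc xc.
    by case/or3P: xq xc => /eqP->; apply/negP.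
  rewrite /= !inE negb_or qq' !andbT; apply/andP; split.
    by apply/eqP=> qz; move: zfree; rewrite -qz qf.
  by apply/eqP=> zq0; move: zfree; rewrite zq0 q'f.
- move=> x; rewrite mem_cat => /orP[/inc/(alt_sub ac)//|].
  by rewrite !inE => /or3P[]/eqP-> //; apply: (subsetP UH).
- by have := alt_size a1'; rewrite size_cat /= => szs; arith.
- have := alt_U a1'; rewrite count_cat /= zU (negPf qU) (negPf q'U) (negPf wU);
  arith.
Qed.

(** The neighbours of [z] outside the cycle, and those of the successors of its
    neighbours on the cycle, are disjoint sets; counting them shows that [z] has
    no neighbour on the cycle at all. Then [z] has more than [m] neighbours among
    the free vertices, and so at least two in common with each vertex of [U] on
    the cycle, which allows a replacement. *)
Lemma not_stuck : False.
Proof.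
pose D := nb z :&: [set y in c].
have DP d : d \in D -> [/\ d \in c, e z d, d \notin U & next c d \in U].
  rewrite !inE => /andP[zd dc].
  have dU: d \notin U by apply: contraL zd => dU; apply: indU.
  by split=> //; apply: next_U.
have lb d : d \in D -> m.+1 - j <= #|nb (next c d) :&: free|.
  by case/DP=> _ _ _ nU; have := deg_free nU; have := deg_c nU; arith.
have: \sum_(d in D) #|nb (next c d) :&: free| <= #|free :\: nb z|.
  apply: sum_disjoint => [d d' q dD d'D|d dD].
    rewrite !in_setI ![_ \in nb _]inE => /andP[nq qf] /andP[nq' _].
    have [dc zd _ _] := DP d dD; have [d'c zd' _ _] := DP d' d'D.
    apply/eqP; apply: contraT => dd'; exfalso.
    exact: (alt_reroute dc d'c dd' zd zd' qf nq nq').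
  apply/subsetP=> q; rewrite in_setI in_setD ![_ \in nb _]inE => /andP[nq qf].
  rewrite qf andbT; apply/negP=> zq; have [dc zd _ _] := DP d dD.
  exact: (alt_insert dc zd qf zq nq).
have: \sum_(d in D) (m.+1 - j) <= \sum_(d in D) #|nb (next c d) :&: free|.
  exact: leq_sum.
rewrite sum_nat_const => le1 le2.
have := cardsID (nb z) free; rewrite card_free setIC => eqf.
have := deg_free zU; rewrite -/D => dz.
have D0: #|D| = 0.
  have le3: #|D| * (m.+1 - j) + #|nb z :&: free| <= m.*2 - j by arith.
  case: #|D| le3 dz => // d le3 dz; exfalso.
  have: m.+1 - j = (m - j).+1 by arith.
  move=> e1; rewrite e1 mulSn mulnS in le3.
  by move: (d * _) le3 => dmj le3; arith.
have [u uc uU]: exists2 u, u \in c & u \in U.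
  by apply/hasP; rewrite has_count (alt_U ac); arith.
have nU: next c (next c u) \in U.
  by apply: next_U; rewrite ?mem_next ?next_nU.
have two x : x \in U -> 2 <= #|nb x :&: (nb z :&: free)|.
  move=> xU; have dx := deg_free xU; have dcx := deg_c xU.
  have := cardsUI (nb x :&: free) (nb z :&: free).
  have -> : (nb x :&: free) :&: (nb z :&: free) = nb x :&: (nb z :&: free).
    by apply/setP=> y; rewrite !in_setI; case: (y \in free); rewrite ?andbF ?andbT.
  have sub: (nb x :&: free) :|: (nb z :&: free) \subset free.
    by rewrite subUset !subsetIr.
  have := subset_leq_card sub; rewrite card_free; arith.
have [q]: exists q, q \in nb u :&: (nb z :&: free).
  by apply/set0Pn; rewrite -card_gt0; have := two u uU; arith.
rewrite !in_setI ![_ \in nb _]inE => /and3P[uq zq qf].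
have [q']: exists q', q' \in (nb (next c (next c u)) :&: (nb z :&: free)) :\ q.
  apply/set0Pn; rewrite -card_gt0.
  have := cardsD1 q (nb (next c (next c u)) :&: (nb z :&: free)).
  by have := two _ nU; case: (q \in _); arith.
rewrite in_setD1 !in_setI ![_ \in nb _]inE => /and4P[q'q nq' zq' q'f].
by apply: (alt_replace uc uU qf q'f _ uq zq zq' nq'); rewrite eq_sym.
Qed.

End Grow.

Lemma alt_base : exists c, alt_cycle c 2.
Proof.
have [x [y [xU yU xy]]]: exists x y, [/\ x \in U, y \in U & x != y].
  by apply/card_gt1P; rewrite cardU; arith.
have cW: #|H :\: U| = m.*2 by rewrite cardsD (setIidPr UH) cardH cardU; arith.
have dW v : v \in U -> m < #|nb v :&: (H :\: U)|.
  move=> vU; apply: leq_trans (degH (subsetP UH v vU)) _.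
  apply/subset_leq_card/subsetP=> t; rewrite !inE => /andP[vt ->].
  by rewrite vt andbT; apply: contraL vt => tU; apply: indU.
have [q [q' [+ + qq']]]: exists q q',
    [/\ q \in nb x :&: nb y :&: (H :\: U), q' \in nb x :&: nb y :&: (H :\: U) & q != q'].
  apply/card_gt1P.
  have := cardsUI (nb x :&: (H :\: U)) (nb y :&: (H :\: U)).
  have sub: (nb x :&: (H :\: U)) :|: (nb y :&: (H :\: U)) \subset H :\: U.
    by rewrite subUset !subsetIr.
  rewrite -setIIl; have := subset_leq_card sub; rewrite cW.
  by have := dW x xU; have := dW y yU; arith.
rewrite !inE => /andP[/andP[xq yq] /andP[qU qH]] /andP[/andP[xq' yq'] /andP[q'U q'H]].
have Nq v : v \in U -> v != q by apply: contraTneq => ->.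
have Nq' v : v \in U -> v != q' by apply: contraTneq => ->.
exists [:: x; q; y; q']; apply: (@alt_cycleI x q') => //.
- by rewrite /= !eqxx altU // xq alt_sym !altU // yq yq'.
- by rewrite alt_sym altU.
- rewrite /= !inE !negb_or xy qq' (Nq x xU) (Nq' x xU) (Nq' y yU) (eq_sym q).
  by rewrite (Nq y yU).
- move=> v; rewrite !inE => /or4P[]/eqP-> //; exact: (subsetP UH).
- by rewrite /= xU yU (negPf qU) (negPf q'U).
Qed.

Lemma no_independent : False.
Proof.
have X j : 1 < j <= m -> exists c, alt_cycle c j.
  elim: j => // j IHj /andP[j1 jm].
  case: (ltngtP 1 j) => [j2|j0|<-]; [|by arith|exact: alt_base].
  have [c ac] : exists c, alt_cycle c j by apply: IHj; rewrite j2 ltnW.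
  have [z zU zc]: exists2 z, z \in U & z \notin c.
    have cU := card_cU ac;
      case: (pickP (fun z => (z \in U) && (z \notin c))) => [z /andP[]|no].
      by exists z.
    suff: #|U| <= #|U :&: [set x in c]| by rewrite cU cardU; arith.
    apply/subset_leq_card/subsetP=> z zU; rewrite !inE zU /=.
    by have := no z; rewrite zU => /negbFE.
  apply: Classical_Prop.NNPP => stuck.
  by apply: (not_stuck ac j2 jm _ zU zc) => c' ac'; apply: stuck; exists c'.
have [|c [cyc uc sc szc _]] := X m; first by arith.
apply: noC; exists c; split=> //.
by apply: sub_cycle cyc => x y /andP[].
Qed.

End Alternating.

Lemma splitting : exists S, sparse_split S.
Proof.
have [v vH]: exists v, v \in H by apply/set0Pn; rewrite -card_gt0 cardH; arith.
pose A := nb v :&: H.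
case: (pickP (fun t : T * T => [&& t.1 \in A, t.2 \in A & e t.1 t.2])) => [[x y]|no].
  rewrite /= !inE => /and3P[/andP[vx xH] /andP[vy yH] xy].
  exact: (splitting_of_triangle vH xH yH vx xy vy).
have [U UA cU]: exists2 U : {set T}, U \subset A & #|U| = m.
  have sz: m <= size (enum A) by rewrite -cardE ltnW // degH.
  exists [set x in take m (enum A)].
    by apply/subsetP=> x; rewrite inE => /mem_take; rewrite mem_enum.
  by rewrite cardsE (card_uniqP _) ?take_uniq ?enum_uniq // size_takel.
exfalso; apply: (@no_independent U) => //.
  by apply: subset_trans UA _; apply: subsetIr.
move=> x y xU yU; apply/negP=> xy; have := no (x, y).
by rewrite /= (subsetP UA x xU) (subsetP UA y yU) xy.
Qed.

End Host.

Lemma subset_between (T : finType) (A K : {set T}) n :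
  K \subset A -> #|K| <= n <= #|A| ->
  exists H : {set T}, [/\ K \subset H, H \subset A & #|H| = n].
Proof.
move=> KA /andP[Kn nA]; pose s := take (n - #|K|) (enum (A :\: K)).
exists (K :|: [set x in s]); split; first exact: subsetUl.
  rewrite subUset KA; apply/subsetP=> x; rewrite inE => /mem_take.
  by rewrite mem_enum inE => /andP[].
rewrite cardsU; have -> : K :&: [set x in s] = set0.
  apply/setP=> x; rewrite !inE; apply/negP=> /andP[xK /mem_take].
  by rewrite mem_enum inE xK.
have us: uniq s by rewrite take_uniq ?enum_uniq.
have szs: size s = n - #|K|.
  by rewrite size_takel // -cardE cardsD (setIidPr KA); arith.
by rewrite cards0 cardsE (card_uniqP us) szs; arith.
Qed.

(** * Two splittings contradict each other *)

Section Wheel.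
Variables (T : finType) (e : rel T) (m : nat).
Hypothesis e_sym : symmetric e.
Hypothesis e_irr : irreflexive e.
Hypothesis m_ge3 : 2 < m.
Hypothesis cardT : #|T| = 5 * m - 1.

Definition non_nb x := [set y | (x != y) && ~~ e x y].
Hypothesis codeg : forall x, #|non_nb x| <= m.*2 - 2.

Lemma nb_ge (A : {set T}) x : x \in A -> #|A| <= #|nb e x :&: A| + m.*2.-1.
Proof.
move=> xA; have sub: A \subset (nb e x :&: A) :|: (x |: non_nb x).
  apply/subsetP=> y yA; rewrite !inE yA andbT eq_sym.
  by case: eqVneq => //=; rewrite ?orbT //; case: (e x y).
apply: leq_trans (subset_leq_card sub) _; apply: leq_trans (leq_card_setU _ _) _.
rewrite leq_add2l cardsU1; have := codeg x; case: (_ \notin _); arith.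
Qed.

Lemma missed_le (A : {set T}) x : x \notin A -> A :&: nb e x = set0 ->
  #|A| <= m.*2 - 2.
Proof.
move=> xA AN; apply: leq_trans (subset_leq_card _) (codeg x).
apply/subsetP=> y yA; rewrite inE; apply/andP; split.
  by apply: contraNneq xA => ->.
apply/negP=> xy; have: y \in A :&: nb e x by rewrite !inE yA.
by rewrite AN inE.
Qed.

Lemma wheel_cycle : exists v, has_cycle e (nb e v) m.*2.
Proof.
apply: Classical_Prop.NNPP => noW.
have X v (K : {set T}) : K \subset nb e v -> #|K| <= 3 * m ->
    exists H S : {set T}, [/\ K \subset H, H \subset nb e v, #|H| = 3 * m &
     sparse_split e H m S].
  move=> KN cK.
  have nv: 3 * m <= #|nb e v|.
    have := @nb_ge setT v (in_setT v); rewrite setIT cardsT cardT; arith.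
  have [|H [KH HN cH]] := @subset_between T (nb e v) K (3 * m) KN; first by arith.
  have [||S XS] := @splitting T e e_sym e_irr H m m_ge3 cH; last by exists H, S.
    by move=> x xH; have := nb_ge xH; arith.
  case=> s [cs us szs ss]; apply: noW; exists v, s; split=> //.
  by move=> x /ss; apply/subsetP.
have [v _]: exists v, v \in [set: T] by apply/set0Pn;
  rewrite -card_gt0 cardsT cardT; arith.
have [|H [S [_ HN cH [SH cS out2 [u uR u1] _]]]] := X v set0 (sub0set _).
  by rewrite cards0.
pose R := H :\: S; pose K := nb e u :&: R.
have uH: u \in H by move: uR; rewrite inE => /andP[].
have cK: m <= #|K|.
  have := nb_ge uH; rewrite -(cardsID S (nb e u :&: H)) -setIDA -/R -/K.
  by rewrite -setIA (setIidPr SH) cH; arith.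
have [||H' [S' [KH' HN' cH' [SH' cS' out2' _ busy']]]] := X u K.
- exact: subsetIl.
- rewrite -cH; apply: subset_leq_card; apply: subset_trans (subsetIr _ _) _.
  exact: subsetDl.
pose R' := H' :\: S'.
(* There are at least m vertices in K and fewer than m busy ones in S'. *)
have [x xK xq]: exists2 x, x \in K & x \notin [set x in S' | 1 < #|nb e x :&: R'|].
  apply/subsetPn; apply/negP=> /subset_leq_card; rewrite -/R' in busy'; arith.
have [ux xR]: e u x /\ x \in R by move: xK; rewrite !in_setI inE => /andP[].
have xH' : x \in H' by apply: (subsetP KH').
have xS : x \notin S by move: xR; rewrite inE => /andP[].
pose M := S :\: nb e x.
have cM: #|S| <= #|M| + 2.
  by rewrite -(cardsID (nb e x) S) setIC addnC leq_add2l; apply: out2.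
have MN: M :&: nb e x = set0 by apply/setP=> y; rewrite !inE andbAC andNb.
have xM: x \notin M by rewrite inE negb_and xS orbT.
(* A set A of non-neighbours of x inside N(u) shares at most one vertex with M,
   so x misses too much as soon as |M| + |A| reaches 2m. *)
have fin (A : {set T}) : x \notin A -> A :&: nb e x = set0 -> A \subset nb e u ->
    m.*2 <= #|M| + #|A| -> False.
  move=> xA AN Au le.
  have inter: #|M :&: A| <= 1.
    apply: leq_trans u1; apply: subset_leq_card; apply/subsetP=> y.
    rewrite !in_setI => /andP[]; rewrite [y \in M]inE => /andP[_ ->].
    by move=> yA; rewrite (subsetP Au).
  have: #|M :|: A| <= m.*2 - 2.
    apply: (@missed_le _ x); first by rewrite inE negb_or xM.
    by rewrite setIUl MN AN setU0.
  by have := cardsUI M A; arith.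
have sub' (A : {set T}) : A \subset H' -> A :\: nb e x \subset nb e u.
  by move=> AH; apply: subset_trans (subsetDl _ _) (subset_trans AH HN').
have dn (A : {set T}) : (A :\: nb e x) :&: nb e x = set0.
  by apply/setP=> y; rewrite !inE andbAC andNb.
case xS': (x \in S'); last first.
  apply: (fin (S' :\: nb e x)); rewrite ?dn ?sub' //.
    by rewrite inE xS' andbF.
  have := out2' x; rewrite inE xS' xH' => /(_ isT).
  by have := cardsID (nb e x) S'; rewrite setIC; arith.
apply: (fin (R' :\: nb e x)); rewrite ?dn ?sub' ?subsetDl //.
  by rewrite !inE xS' andbF.
move: xq; rewrite inE xS' /= -leqNgt.
have := cardsID (nb e x) R'; rewrite setIC.
have : #|R'| = 3 * m - #|S'| by rewrite cardsD (setIidPr SH') cH'.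
arith.
Qed.

End Wheel.

Lemma contains_wheel (G : sgraph) n (v : G) : 2 < n ->
  has_cycle (@edge G) (nb (@edge G) v) n -> contains G (wheel n).
Proof.
move=> n2 [s [cs us szs ss]].
have fin (i : 'I_n) : nth v s i \in s by rewrite mem_nth // szs.
have ev (i : 'I_n) : edge v (nth v s i) by have := ss _ (fin i); rewrite inE.
have stepn i : i < n -> edge (nth v s i) (nth v s (i.+1 %% n)).
  move=> lt_i; case: s cs szs {us ss fin ev} => [|x t] /=; first by move=> _ n0;
    rewrite -n0 in n2.
  move=> /(pathP v) ps szt; have := ps i; rewrite size_rcons szt => /(_ lt_i).
  rewrite -rcons_cons nth_rcons /= szt lt_i nth_rcons.
  case: (ltngtP i (size t)) => [lt|gt|eqi].
  - by rewrite modn_small //; rewrite -szt ltnS.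
  - by move: lt_i; rewrite -szt ltnS leqNgt gt.
  - by rewrite eqi szt modnn.
have step (i : 'I_n) : edge (nth v s i) (nth v s (ordS i)) by exact: stepn.
pose f (u : wheel n) : G := if u is Some i then nth v s (i : 'I_n) else v.
exists f.
  move=> [i|] [j|] //=.
  - move/eqP; rewrite nth_uniq ?szs // => /eqP ij; congr Some; exact: val_inj.
  - by move=> eqv; have := ev i; rewrite eqv edge_irrefl.
  - by move=> eqv; have := ev j; rewrite -eqv edge_irrefl.
move=> [i|] [j|] //=; last by rewrite edge_sym.
case/andP=> _ /orP[/eqP->|/eqP->] //; by rewrite edge_sym.
Qed.

Lemma contains_co_star (G : sgraph) n (x : G) : 0 < n ->
  n.-1 <= #|non_nb (@edge G) x| -> contains (complement G) (star n).
Proof.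
move=> n0 le; set A := non_nb _ x in le.
pose s := enum A.
have szs: n.-1 <= size s by rewrite -cardE.
have sA y : y \in s -> (x != y) && ~~ edge x y by rewrite mem_enum inE.
pose f (u : star n) : complement G := if u is inr i then nth x s (i : 'I_n.-1) else x.
have lt (i : 'I_n.-1) : i < size s by apply: leq_trans (ltn_ord i) szs.
have xi (i : 'I_n.-1) : compl_edge x (nth x s i) by apply/sA/mem_nth.
exists f.
  move=> [i|i] [j|j] //=.
  - by rewrite (ord1 i) (ord1 j).
  - by move=> eqx; have := xi j; rewrite -eqx compl_edge_irrefl.
  - by move=> eqx; have := xi i; rewrite eqx compl_edge_irrefl.
  - move/eqP; rewrite nth_uniq ?enum_uniq // => /eqP ij; congr inr; exact: val_inj.
move=> [i|i] [j|j] //= _; by [apply: xi | rewrite compl_edge_sym; apply: xi].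
Qed.

(** * The Ramsey number *)

Lemma ramsey_number_le (G1 G2 : sgraph) N : 0 < N -> ramsey_prop G1 G2 N ->
  exists2 r, is_ramsey_number G1 G2 r & r <= N.
Proof.
elim/ltn_ind: N => N IHN N0 PN.
case: (Classical_Prop.classic (exists M, [/\ M < N, 0 < M & ramsey_prop G1 G2 M])).
  case=> M [MN M0 PM]; have [r Pr rM] := IHN M MN M0 PM.
  by exists r => //; apply: leq_trans rM (ltnW MN).
move=> minN; exists N => //; split=> // M M0 PM; rewrite leqNgt; apply/negP=> MN.
by apply: minN; exists M.
Qed.

Theorem theorem3 (n : nat) (n_ge6 : 6 <= n) (n_even : ~~ odd n) :
  exists2 r : nat, is_ramsey_number (wheel n) (star n) r & r <= (5 * n) %/ 2 - 1.
Proof.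
pose m := n./2; have nm: n = m.*2 by rewrite halfK (negPf n_even) subn0.
have eqN: (5 * n) %/ 2 - 1 = 5 * m - 1 by arith.
rewrite eqN; apply: ramsey_number_le => [|G cG]; first by arith.
case: (Classical_Prop.classic (contains (complement G) (star n)))
  => [|noS];
  first by right.
left; have [||||v] := @wheel_cycle G (@edge G) m _ _ _ cG.
- exact: edge_sym.
- exact: edge_irrefl.
- by arith.
- move=> x; rewrite leqNgt; apply/negP=> lt; apply: noS.
  by apply: (@contains_co_star G n x); arith.
by rewrite -nm; apply: contains_wheel; arith.
Qed.
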